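(* Let $D\ge1$ and consider depth-2 linear convolutional networks with parameters $\mathbf{u}=[\mathbf{u}_1,\mathbf{u}_2]$, $\mathbf{u}_l\in\mathbb{R}^D$, computing $f_{\mathbf{u}}(\mathbf{x})=(\mathbf{x}\star\mathbf{u}_1)^\top\mathbf{u}_2=\langle\mathbf{x},\mathcal{P}_{conv}(\mathbf{u})\rangle$. For almost all linearly separable datasets $\{(\mathbf{x}_n,y_n)\}_{n=1}^N\subset\mathbb{R}^D\times\{-1,1\}$, almost all initializations $\mathbf{u}^{(0)}$, and any sequence of step sizes $\{\eta_t\}$ with $\eta_t$ smaller than the local Lipschitz constant (of the gradient) at $\mathbf{u}^{(t)}$, consider the gradient descent iterates $\mathbf{u}^{(t+1)}=\mathbf{u}^{(t)}-\eta_t\nabla_{\mathbf{u}}\mathcal{L}_{\mathcal{P}_{conv}}(\mathbf{u}^{(t)})$ with $\mathcal{L}_{\mathcal{P}_{conv}}(\mathbf{u})=\sum_{n=1}^N\exp(-y_n\langle\mathbf{x}_n,\mathcal{P}_{conv}(\mathbf{u})\rangle)$, and let $\mathbf{w}^{(t)}=\mathcal{P}_{conv}(\mathbf{u}^{(t)})$, $\mathcal{L}(\mathbf{w})=\sum_n\exp(-y_n\langle\mathbf{x}_n,\mathbf{w}\rangle)$. Suppose (a) $\mathcal{L}_{\mathcal{P}_{conv}}(\mathbf{u}^{(t)})\to0$; (b) $\mathbf{u}^{(t)}$ converges in direction, yielding a limit direction $\bar{\mathbf{w}}^\infty=\lim_t\mathbf{w}^{(t)}/\|\mathbf{w}^{(t)}\|$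 with positive margin $\min_n y_n\langle\mathbf{x}_n,\bar{\mathbf{w}}^\infty\rangle>0$; (c) the phases of the Fourier coefficients of $\mathbf{w}^{(t)}$ converge coordinate-wise, i.e. for every $d$, $e^{\mathrm{i}\phi_{\hat{\mathbf{w}}^{(t)}[d]}}$ converges; (d) the gradients $\nabla_{\mathbf{w}}\mathcal{L}(\mathbf{w}^{(t)})$ converge in direction. Then $$\bar{\mathbf{w}}^\infty=\frac{\mathbf{w}^*_{\mathcal{F},1}}{\|\mathbf{w}^*_{\mathcal{F},1}\|},\qquad \mathbf{w}^*_{\mathcal{F},1}=\operatorname{argmin}_{\mathbf{w}}\|\hat{\mathbf{w}}\|_1\ \text{ s.t. }\ \forall n,\ y_n\langle\mathbf{w},\mathbf{x}_n\rangle\ge1.$$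
   Context: Vectors in $\mathbb{R}^D$ are indexed $0,\dots,D-1$. Circular convolution: $(\mathbf{h}\star\mathbf{u})[d]=\frac{1}{\sqrt D}\sum_{k=0}^{D-1}\mathbf{u}[k]\,\mathbf{h}[(d+k)\bmod D]$. $\mathcal{P}_{conv}(\mathbf{u})\in\mathbb{R}^D$ is the unique vector with $f_{\mathbf{u}}(\mathbf{x})=\langle\mathbf{x},\mathcal{P}_{conv}(\mathbf{u})\rangle$ for all $\mathbf{x}$. The discrete Fourier transform is $\hat{\mathbf{w}}[d]=\frac{1}{\sqrt D}\sum_{p=0}^{D-1}\mathbf{w}[p]e^{-2\pi\mathrm{i}pd/D}$; a complex number is written $z=|z|e^{\mathrm{i}\phi_z}$ with $\phi_z\in[0,2\pi)$. ''Converges in direction'' means $\mathbf{v}^{(t)}/\|\mathbf{v}^{(t)}\|$ has a limit. ''Almost all'' means outside a Lebesgue-null set.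
   Formalization: The step size is required to be positive and below the inverse of the local Lipschitz constant of the gradient (literally ''smaller than the Lipschitz constant'' makes the claim false), N is at least 1, and argmin is read as ''some minimizer''. *)

(* Defs.v *)
From HB Require Import structures.
From mathcomp Require Import all_boot all_order all_algebra.
From mathcomp Require Import all_classical all_reals all_analysis.
Set Implicit Arguments. Unset Strict Implicit. Unset Printing Implicit Defensive.
Import Order.TTheory GRing.Theory Num.Theory.
Import numFieldNormedType.Exports.
Local Open Scope classical_set_scope.
Local Open Scope ring_scope.

Section Defs.
Variable R : realType.

Definition dot n (x w : 'rV[R]_n) : R := \sum_(i < n) x 0 i * w 0 i.
Definition norm2 n (x : 'rV[R]_n) : R := Num.sqrt (dot x x).

Definition grad n (f : 'rV[R]_n -> R) (x : 'rV[R]_n) : 'rV[R]_n :=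
  \row_(i < n) derive f x (delta_mx 0 i).

Lemma ord_pos D (d : 'I_D) : (0 < D)%N.
Proof. by apply: leq_ltn_trans (ltn_ord d). Qed.
Definition addmodI D (d k : 'I_D) : 'I_D :=
  Ordinal (ltn_pmod (d + k) (ord_pos d)).

Definition cconv D (h u : 'rV[R]_D) : 'rV[R]_D :=
  \row_(d < D) ((Num.sqrt (D%:R))^-1 *
                \sum_(k < D) u 0 k * h 0 (addmodI d k)).

Definition fconv D (u : 'rV[R]_(D + D)) (x : 'rV[R]_D) : R :=
  dot (cconv x (lsubmx u)) (rsubmx u).

Definition Pconv D (u : 'rV[R]_(D + D)) : 'rV[R]_D :=
  xget 0 [set w | forall x, fconv u x = dot x w].

Definition Lw D N (X : 'I_N -> 'rV[R]_D) (y : 'I_N -> R) (w : 'rV[R]_D) : R :=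
  \sum_(n < N) expR (- (y n * dot (X n) w)).
Definition Lconv D N (X : 'I_N -> 'rV[R]_D) (y : 'I_N -> R)
  (u : 'rV[R]_(D + D)) : R := Lw X y (Pconv u).

(* DFT: real and imaginary parts of
   what[d] = 1/sqrt D sum_p w[p] e^{-2 pi i p d / D} *)
Definition dft_re D (w : 'rV[R]_D) (d : 'I_D) : R :=
  (Num.sqrt (D%:R))^-1 *
  \sum_(p < D) w 0 p * cos (2 * pi * (p%:R * d%:R) / D%:R).
Definition dft_im D (w : 'rV[R]_D) (d : 'I_D) : R :=
  - ((Num.sqrt (D%:R))^-1 *
  \sum_(p < D) w 0 p * sin (2 * pi * (p%:R * d%:R) / D%:R)).
Definition dft_abs D (w : 'rV[R]_D) (d : 'I_D) : R :=
  Num.sqrt (dft_re w d ^+ 2 + dft_im w d ^+ 2).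

(* phase factor e^{i phi_z} = z/|z| (with the convention phi_0 = 0,
   i.e. e^{i phi_0} = 1), real and imaginary parts *)
Definition phase_re D (w : 'rV[R]_D) (d : 'I_D) : R :=
  if dft_abs w d == 0 then 1 else dft_re w d / dft_abs w d.
Definition phase_im D (w : 'rV[R]_D) (d : 'I_D) : R :=
  if dft_abs w d == 0 then 0 else dft_im w d / dft_abs w d.

Definition fourier_l1 D (w : 'rV[R]_D) : R := \sum_(d < D) dft_abs w d.

Definition dir n (v : 'rV[R]_n) : 'rV[R]_n := (norm2 v)^-1 *: v.

Definition cvg_dir n (v : nat -> 'rV[R]_n) : Prop :=
  exists l : 'rV[R]_n, (fun t => dir (v t)) @ \oo --> l.

Definition in_box m n (lo hi x : 'M[R]_(m, n)) : Prop :=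
  forall i j, lo i j <= x i j <= hi i j.
Definition box_vol m n (lo hi : 'M[R]_(m, n)) : R :=
  \prod_(i < m) \prod_(j < n) (hi i j - lo i j).
Definition leb_null m n (A : set 'M[R]_(m, n)) : Prop :=
  forall eps : R, 0 < eps ->
  exists lo hi : nat -> 'M[R]_(m, n),
    (forall k i j, lo k i j <= hi k i j) /\
    (forall x, A x -> exists k, in_box (lo k) (hi k) x) /\
    (forall K, \sum_(k < K) box_vol (lo k) (hi k) < eps).

Definition grad_lipschitz_on n (f : 'rV[R]_n -> R) (c : 'rV[R]_n) (r beta : R) :=
  forall a b, norm2 (a - c) <= r -> norm2 (b - c) <= r ->
    norm2 (grad f a - grad f b) <= beta * norm2 (a - b).

End Defs.

(* Main.v *)
(** In the Fourier domain the network decouples: with a, b the transforms of u_1,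
    u_2 at frequency d and c = eta * z^[d], where z = - grad L(w), a step of gradient
    descent is a' = a + c b^*, b' = b + c a^*, and w^[d] = a b.  For
    S = (|a|^2 + |b|^2) / 2 the quantity S^2 - |w^[d]|^2 = (|a|^2 - |b|^2)^2 / 4 is
    multiplied by (1 - |c|^2)^2, and |c| < 1 by the step size condition.  Outside the
    null set where |a| = |b| initially, this forbids S to follow the contracting
    direction, so when z / |z| converges to zbar with zbar^[d] <> 0, S grows like
    the product of the 1 + 2 eta |z| |zbar^[d]|, and w^[d] aligns with the phase of
    zbar^[d].  Only the frequencies maximizing |zbar^[d]| survive in the limit
    direction, that is <zbar, wbar> = max_d |zbar^[d]| * l1(wbar).  Since zbar is a
    limit of nonnegative combinations of the y_n x_n concentrating on the samples of
    minimal margin, zbar is a dual certificate for the optimality of wbar. *)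
Require Import Defs.
From HB Require Import structures.
From mathcomp Require Import all_boot all_order all_algebra.
From mathcomp Require Import all_classical all_reals all_analysis.
From mathcomp Require Import ring lra.
Import Order.TTheory GRing.Theory Num.Theory.
Import numFieldNormedType.Exports.
Local Open Scope classical_set_scope.
Local Open Scope ring_scope.

(** Time is measured by [h = eta * |z|]: the increments [c] are [h] times a convergent vector, up to
    [o(h)]. Two properties of this clock come from the loss. [h] tends to 0 because the Lipschitz
    constant near [u] bounds every second directional derivative, in particular the one along [u]
    itself; the sum of [h] diverges because a vanishing loss forces unbounded weights, while one
    late step multiplies the energies by at most [1 + 3 h]. The obstacle is that [z / |z|] converges
    without a rate: the perturbations of the linear recursion are only [o(h)] and need not be
    summable, so growth bounds alone would let a trajectory stay on the contracting side forever.
    The gap excludes this because it loses only a factor [1 - o(h)] per step, [|c|^2] being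
    [O(h^2)]. For the same reason two frequencies are compared through their growth factors, with a
    tolerance proportional to the difference of their moduli. The bound [|c| < 1] also comes from
    second derivatives, along directions supported at a single frequency. *)

(** * Recursions driven by a divergent series *)

Section Sequences.
Variables (R : realType) (h : nat -> R).
Hypothesis h_ge0 : forall t, 0 <= h t.

Definition series_diverges :=
  forall C : R, \forall t \near \oo, C <= \sum_(s < t) h s.

(** Decay like [1 / (1 + c * H)], with [H] the partial sums, is enough, and it follows inductively
    from [(1 - x) * (1 + q + x) <= 1 + q] for [x, q >= 0]. *)
Lemma contraction_le_eps (c : R) (Y : nat -> R) :
  series_diverges -> 0 < c -> (forall t, 0 <= Y t) ->
  (\forall t \near \oo, Y t.+1 <= (1 - c * h t) * Y t) ->
  forall eps : R, 0 < eps -> \forall t \near \oo, Y t <= eps.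
Proof.
move=> Hdiv c0 Y0 [T _ HT] eps e0.
pose H t := \sum_(s < t) h s.
have HS t : H t.+1 = H t + h t by rewrite /H big_ord_recr.
have Hmono k : H T <= H (T + k)%N.
  elim: k => [|k IH]; first by rewrite addn0.
  by rewrite addnS HS (le_trans IH)// lerDl.
have key k : Y (T + k)%N * (1 + c * (H (T + k)%N - H T)) <= Y T.
  elim: k => [|k IH]; first by rewrite addn0 subrr mulr0 addr0 mulr1.
  apply: le_trans IH; rewrite addnS HS.
  have := HT (T + k)%N (leq_addr _ _) => /= Hk.
  have := Hmono k; have := Y0 (T + k)%N; have := h_ge0 (T + k)%N.
  move: (Y (T + k)%N) (H (T + k)%N) (h (T + k)%N) (Y (T + k).+1) Hk => y m x y'.
  move=> Hk x0 y0 HTm.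
  have q0 : 0 <= 1 + c * (m + x - H T).
    by rewrite addr_ge0// mulr_ge0// ?(ltW c0)// subr_ge0 (le_trans HTm)// lerDl.
  apply: (le_trans (ler_wpM2r q0 Hk)).
  have p0 : 0 <= y * (c * x * (c * (m - H T) + c * x)).
    by rewrite mulr_ge0// mulr_ge0 ?addr_ge0 ?mulr_ge0 ?subr_ge0// ltW.
  by rewrite -subr_ge0; apply: (le_trans p0); rewrite le_eqVlt; apply/orP; left;
     apply/eqP; ring.
have [T' _ HT'] := Hdiv (H T + Y T / (c * eps)).
exists (maxn T T') => // t /=; rewrite geq_max => /andP[tT tT'].
have := HT' t tT'; rewrite /= -/(H t) => Ht.
have := key (t - T)%N; rewrite subnKC// => kt.
have ce0 : 0 < c * eps by rewrite mulr_gt0.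
have H1 : Y T <= c * eps * (H t - H T).
  by rewrite -ler_pdivrMl// lerBrDl mulrC.
rewrite leNgt; apply/negP => Yt.
have Ht0 : 0 <= H t - H T by have := Hmono (t - T)%N; rewrite subnKC// subr_ge0.
have : Y t * (1 + c * (H t - H T)) <= c * eps * (H t - H T) by exact: le_trans kt H1.
apply/negP; rewrite -ltNge.
have q0 : 0 <= c * (H t - H T) by rewrite mulr_ge0// ltW.
have -> : c * eps * (H t - H T) = eps * (c * (H t - H T)) by ring.
have := ler_wpM2r q0 (ltW Yt); have := lt_trans e0 Yt.
by move: (c * (H t - H T)) => q *; nra.
Qed.

(** Since [1 + x <= expR x], a bound on the partial sums of [h] would bound [V]. *)
Lemma unbounded_series_diverges (C : R) (V : nat -> R) :
  0 <= C -> (forall t, 0 <= V t) ->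
  (\forall t \near \oo, V t.+1 <= (1 + C * h t) * V t) ->
  (forall M : R, \forall t \near \oo, M <= V t) -> series_diverges.
Proof.
move=> C0 V0 [T _ HT] Vub M.
pose H t := \sum_(s < t) h s.
have HS t : H t.+1 = H t + h t by rewrite /H big_ord_recr.
have Hmono t k : H t <= H (t + k)%N.
  elim: k => [|k IH]; first by rewrite addn0.
  by rewrite addnS HS (le_trans IH)// lerDl.
have key k : V (T + k)%N <= V T * expR (C * (H (T + k)%N - H T)).
  elim: k => [|k IH]; first by rewrite addn0 subrr mulr0 expR0 mulr1.
  rewrite addnS HS.
  have := HT (T + k)%N (leq_addr _ _) => /= Hk.
  apply: (le_trans Hk).
  have -> : C * (H (T + k)%N + h (T + k)%N - H T) =
     C * h (T + k)%N + C * (H (T + k)%N - H T) by ring.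
  rewrite expRD mulrCA; apply: ler_pM => //.
    by rewrite addr_ge0// mulr_ge0.
  exact: expR_ge1Dx.
have [[t Ht]|nex] := pselect (exists t, M <= H t).
  exists t => // s /= ts; apply: (le_trans Ht).
  by have := Hmono t (s - t)%N; rewrite subnKC.
have Hlt t : H t < M by rewrite ltNge; apply/negP => ?; apply: nex; exists t.
have [T' _ HT'] := Vub (V T * expR (C * (M - H T)) + 1).
have := HT' (T + T')%N (leq_addl _ _) => /= /le_trans/(_ (key T')).
rewrite leNgt => /negP; case.
apply: (@le_lt_trans _ _ (V T * expR (C * (M - H T)))); last by rewrite ltrDl.
by rewrite ler_wpM2l// ler_expR ler_wpM2l// lerB// ltW.
Qed.

(* The invariant [G] excludes the stable direction: if [A <= B] persisted then
   [B] would contract at rate [rho h], so [A * B <= B ^+ 2] would decay faster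
   than its lower bound [G]. *)
Lemma expanding_direction_dominates (rho : R) (A B G : nat -> R) :
  series_diverges -> h @ \oo --> 0 -> 0 < rho ->
  (forall t, 0 <= A t) -> (forall t, 0 <= B t) ->
  (forall t, 0 < G t) -> (forall t, G t <= A t * B t) ->
  (forall eps : R, 0 < eps -> \forall t \near \oo,
     [/\ (1 + 2 * rho * h t) * A t - eps * h t * (A t + B t) <= A t.+1,
         B t.+1 <= (1 - 2 * rho * h t) * B t + eps * h t * (A t + B t) &
         (1 - eps * h t) * G t <= G t.+1]) ->
  forall eps : R, 0 < eps -> \forall t \near \oo, B t <= eps * A t.
Proof.
move=> Hdiv h0 rho0 A0 B0 G0 GAB rec eps e0.
have hsmall : \forall t \near \oo, rho * h t <= 4^-1.
  have r4 : 0 < 4^-1 / rho by rewrite divr_gt0.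
  apply: filterS (cvgr0_norm_le h h0 (4^-1 / rho) r4) => t.
  by rewrite ger0_norm// ler_pdivlMr// mulrC.
(* With tolerance [rho / 4] and [x = rho * h], the regime [A <= B] makes [B] shrink by [1 - x] at
   least while [G] keeps a factor [1 - x]; hence [B ^+ 2 / G] contracts, although [G <= A * B] keeps
   it above 1. *)
have r4 : 0 < rho / 4 by rewrite divr_gt0.
have [T _ HT] : \forall t \near \oo, rho * h t <= 4^-1 /\
   [/\ (1 + 2 * rho * h t) * A t - rho / 4 * h t * (A t + B t) <= A t.+1,
         B t.+1 <= (1 - 2 * rho * h t) * B t + rho / 4 * h t * (A t + B t) &
         (1 - rho / 4 * h t) * G t <= G t.+1].
  by near=> t; split; near: t => //; exact: rec.
have [[t0 [Tt0 AB0]]|nex] := pselect (exists t, (T <= t)%N /\ B t <= A t); last first.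
  exfalso.
  have BA t : (T <= t)%N -> A t <= B t.
    by move=> Tt; rewrite leNgt; apply/negP => ?; apply: nex; exists t; split => //; exact: ltW.
  have Y0 t : 0 <= B t ^+ 2 / G t by rewrite divr_ge0 ?sqr_ge0 ?ltW.
  have Yrec : \forall t \near \oo,
      B t.+1 ^+ 2 / G t.+1 <= (1 - rho * h t) * (B t ^+ 2 / G t).
    exists T => // t /= Tt.
    have [hx [_ HB HG]] := HT t Tt.
    have := BA t Tt; have := G0 t; have := G0 t.+1; have := h_ge0 t.
    have := B0 t; have := B0 t.+1.
    rewrite mulrA ler_pdivrMr// mulrAC ler_pdivlMr//.
    move: hx HB HG.
    have -> : rho / 4 * h t = (rho * h t) / 4 by ring.
    have -> : 2 * rho * h t = 2 * (rho * h t) by ring.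
    move=> hx HB HG B'0 Bt0 ht0 G'0 Gt0 ABt.
    have x0 : 0 <= rho * h t by rewrite mulr_ge0// ltW.
    move: (rho * h t) hx HB HG x0 => x hx HB HG x0.
    have HB1 : B t.+1 <= (1 - x) * B t by nra.
    have HB2 : B t.+1 ^+ 2 <= ((1 - x) * B t) ^+ 2 by rewrite ler_sqr ?nnegrE//; nra.
    apply: (le_trans (ler_wpM2r (ltW Gt0) HB2)).
    have HG2 : (1 - x) * G t <= G t.+1 by apply: le_trans HG; nra.
    have -> : ((1 - x) * B t) ^+ 2 * G t = (1 - x) * B t ^+ 2 * ((1 - x) * G t) by ring.
    by apply: ler_wpM2l => //; rewrite mulr_ge0// ?sqr_ge0//; lra.
  have [T' _ HT'] := contraction_le_eps rho _ Hdiv rho0 Y0 Yrec 2^-1 ltac:(by rewrite invr_gt0).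
  have := HT' (T + T')%N (leq_addl _ _) => /=.
  have TT : (T <= T + T')%N by exact: leq_addr.
  have := G0 (T + T')%N => G00; rewrite ler_pdivrMr//.
  have := GAB (T + T')%N; have := BA _ TT; have := B0 (T + T')%N; nra.
(* The tolerance is small against the difference of the two rates, so [B <= A] persists once
   reached. *)
have ABt k : B (t0 + k)%N <= A (t0 + k)%N.
  elim: k => [|k IH]; first by rewrite addn0.
  rewrite addnS.
  have [hx [HA HB _]] := HT (t0 + k)%N (leq_trans Tt0 (leq_addr _ _)).
  move: hx HA HB.
  have -> : rho / 4 * h (t0 + k)%N = (rho * h (t0 + k)%N) / 4 by ring.
  have -> : 2 * rho * h (t0 + k)%N = 2 * (rho * h (t0 + k)%N) by ring.
  have x0 : 0 <= rho * h (t0 + k)%N by rewrite mulr_ge0// ltW.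
  have := A0 (t0 + k)%N; have := B0 (t0 + k)%N.
  move: (rho * _) x0 => x x0 *; nra.
have Apos t : 0 < A t.
  rewrite lt_neqAle A0 andbT eq_sym; apply/negP => /eqP A00.
  by have := GAB t; rewrite A00 mul0r leNgt G0.
(* The factor [eps / 2] keeps the error below the slack [x * (eps / 2)] gained by subtracting
   [eps / 2] from the ratio; the cap at 1 keeps [A] nondecreasing. *)
pose e1 := Num.min (eps / 2) 1 * rho / 4.
have m0 : 0 < Num.min (eps / 2) 1 by rewrite lt_min ltr01 divr_gt0.
have e10 : 0 < e1 by rewrite /e1 !mulr_gt0.
(* The ratio itself contracts only down to the error level, so its excess over [eps / 2] is tracked,
   truncated at 0 to stay nonnegative. *)
pose Y t := Num.max (B t / A t - eps / 2) 0.
have Y0 t : 0 <= Y t by rewrite /Y le_max lexx orbT.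
have Yrec : \forall t \near \oo, Y t.+1 <= (1 - rho * h t) * Y t.
  have [T1 _ HT1] := rec _ e10.
  exists (maxn t0 (maxn T T1)) => // t /=; rewrite !geq_max => /and3P[tt0 tT tT1].
  have [HA HB _] := HT1 t tT1.
  have [hx _] := HT t tT.
  have := ABt (t - t0)%N; rewrite subnKC// => BAt.
  have x0 : 0 <= rho * h t by rewrite mulr_ge0// ltW.
  rewrite {1}/Y ge_max; apply/andP; split; last by rewrite mulr_ge0//; lra.
  apply: (@le_trans _ _ ((1 - rho * h t) * (B t / A t - eps / 2))); last first.
    by rewrite ler_wpM2l ?le_max ?lexx//; lra.
  rewrite lerBlDr ler_pdivrMr//.
  move: HA HB; rewrite /e1.
  have -> : Num.min (eps / 2) 1 * rho / 4 * h t = Num.min (eps / 2) 1 * (rho * h t) / 4 by ring.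
  have -> : 2 * rho * h t = 2 * (rho * h t) by ring.
  have m1 : Num.min (eps / 2) 1 <= 1 by rewrite ge_min lexx orbT.
  have m2 : Num.min (eps / 2) 1 <= eps / 2 by rewrite ge_min lexx.
  move: (Num.min (eps / 2) 1) m0 m1 m2 (rho * h t) hx x0 => m m0 m1 m2 x hx x0 HA HB.
  have Ba : B t = (B t / A t) * A t by rewrite divfK// gt_eqF.
  have r0 : 0 <= B t / A t by rewrite divr_ge0.
  have r1 : B t / A t <= 1 by rewrite ler_pdivrMr// mul1r.
  move: (B t / A t) Ba r0 r1 => r Ba r0 r1.
  have mx : 0 <= m * x by rewrite mulr_ge0// ltW.
  have mx1 : m * x <= x by rewrite ler_piMl.
  have mx2 : m * x <= eps / 2 * x by rewrite ler_wpM2r.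
  have HA2 : A t <= A t.+1.
    apply: le_trans HA; rewrite Ba; have := Apos t.
    move: (m * x) mx mx1 mx2 => w; nra.
  have q0 : 0 <= (1 - x) * (r - eps / 2) + eps / 2.
    have -> : (1 - x) * (r - eps / 2) + eps / 2 = (1 - x) * r + x * (eps / 2) by ring.
    have e20 : 0 <= eps / 2 by rewrite divr_ge0 ?ltW.
    by rewrite addr_ge0// mulr_ge0//; lra.
  apply: le_trans (ler_wpM2l q0 HA2).
  apply: (le_trans HB); rewrite Ba.
  have -> : (1 - 2 * x) * (r * A t) + m * x / 4 * (A t + r * A t) =
     ((1 - 2 * x) * r + m * x / 4 * (1 + r)) * A t by ring.
  rewrite ler_wpM2r ?(ltW (Apos t))//.
  have xr0 : 0 <= x * r by rewrite mulr_ge0.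
  have wr : m * x * r <= m * x by rewrite ler_piMr.
  move: (m * x) mx mx1 mx2 wr => w *; lra.
have := contraction_le_eps rho _ Hdiv rho0 Y0 Yrec (eps / 2) ltac:(by rewrite divr_gt0).
apply: filterS => t; rewrite /Y ge_max => /andP[+ _].
by rewrite lerBlDr -splitr ler_pdivrMr.
Unshelve. all: by end_near. Qed.

End Sequences.

(** * Dynamics of a single frequency *)

Section FrequencyDynamics.
Variable R : realType.

Lemma dot2_le_norm (x y u v r s : R) : 0 <= r -> 0 <= s ->
  x ^+ 2 + y ^+ 2 <= r ^+ 2 -> u ^+ 2 + v ^+ 2 <= s ^+ 2 -> `|x * u + y * v| <= r * s.
Proof.
move=> r0 s0 H1 H2.
rewrite -ler_sqr ?nnegrE ?mulr_ge0// real_normK ?num_real// exprMn.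
apply: (@le_trans _ _ ((x ^+ 2 + y ^+ 2) * (u ^+ 2 + v ^+ 2))).
  rewrite -subr_ge0.
  have -> : (x ^+ 2 + y ^+ 2) * (u ^+ 2 + v ^+ 2) - (x * u + y * v) ^+ 2 = (x * v - y * u) ^+ 2 by ring.
  exact: sqr_ge0.
by apply: ler_pM => //; rewrite addr_ge0// sqr_ge0.
Qed.

(* For one frequency of modulus [rho], [(S, W)] evolves by Lorentz boosts driven
   by [c = eta * z^[d]]: [S ^+ 2 - |W| ^+ 2] is only rescaled, and [S + K],
   [S - K] with [K = Re (e^{-i psi} W)] are the expanding and contracting
   coordinates, [psi] being the limit phase of [c]. *)
Variables (h S Wr Wi cr ci : nat -> R) (zr zi rho : R).
Hypothesis h_ge0 : forall t, 0 <= h t.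
Hypothesis h_cvg0 : h @ \oo --> 0.
Hypothesis h_div : series_diverges R h.
Hypothesis S_ge0 : forall t, 0 <= S t.
Hypothesis W_le_S : forall t, Wr t ^+ 2 + Wi t ^+ 2 <= S t ^+ 2.
Hypothesis W_lt_S : Wr 0%N ^+ 2 + Wi 0%N ^+ 2 < S 0%N ^+ 2.
Hypothesis c_lt1 : forall t, cr t ^+ 2 + ci t ^+ 2 < 1.
Hypothesis S_rec : forall t,
  S t.+1 = (1 + (cr t ^+ 2 + ci t ^+ 2)) * S t + 2 * (cr t * Wr t + ci t * Wi t).
Hypothesis Wr_rec : forall t, Wr t.+1 = Wr t + 2 * cr t * S t
  + ((cr t ^+ 2 - ci t ^+ 2) * Wr t + 2 * cr t * ci t * Wi t).
Hypothesis Wi_rec : forall t, Wi t.+1 = Wi t + 2 * ci t * S t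
  + (2 * cr t * ci t * Wr t - (cr t ^+ 2 - ci t ^+ 2) * Wi t).
Hypothesis c_asymp : forall eps : R, 0 < eps -> \forall t \near \oo,
  (cr t - h t * zr) ^+ 2 + (ci t - h t * zi) ^+ 2 <= (eps * h t) ^+ 2.
Hypothesis rho_ge0 : 0 <= rho.
Hypothesis rhoE : zr ^+ 2 + zi ^+ 2 = rho ^+ 2.

Lemma c_sqr_small (eps : R) : 0 < eps ->
  \forall t \near \oo, cr t ^+ 2 + ci t ^+ 2 <= eps * h t.
Proof.
move=> e0.
have k0 : 0 < 2 * (1 + rho ^+ 2) by rewrite mulr_gt0// ltr_wpDr// sqr_ge0.
have e10 : 0 < eps / (2 * (1 + rho ^+ 2)) by rewrite divr_gt0.
near=> t.
have H1 : (cr t - h t * zr) ^+ 2 + (ci t - h t * zi) ^+ 2 <= (1 * h t) ^+ 2.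
  by near: t; exact: c_asymp.
have H2 : h t <= eps / (2 * (1 + rho ^+ 2)).
  near: t; apply: filterS (cvgr0_norm_le h h_cvg0 _ e10) => t.
  by rewrite ger0_norm.
rewrite ler_pdivlMr// in H2.
have H3 : cr t ^+ 2 + ci t ^+ 2 <= h t * (h t * (2 * (1 + rho ^+ 2))).
  (* Expanding [(c - 2 h z)^2 >= 0] gives [c^2 <= 2 (c - h z)^2 + 2 h^2 z^2]. *)
  have A1 := sqr_ge0 (cr t - 2 * h t * zr).
  have A2 := sqr_ge0 (ci t - 2 * h t * zi).
  have -> : h t * (h t * (2 * (1 + rho ^+ 2))) =
     2 * h t ^+ 2 + 2 * (h t ^+ 2 * rho ^+ 2) by ring.
  rewrite -rhoE; nra.
by apply: (le_trans H3); rewrite mulrC ler_wpM2r.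
Unshelve. all: by end_near. Qed.

(** Proved with [rho] possibly 0, because it is applied to frequencies at which the limit gradient
    may vanish. *)
Lemma S_growth_le (eps : R) : 0 < eps ->
  \forall t \near \oo, S t.+1 <= (1 + 2 * (rho + eps) * h t) * S t.
Proof.
move=> e0.
have e20 : 0 < eps / 2 by rewrite divr_gt0.
near=> t.
have H1 : cr t ^+ 2 + ci t ^+ 2 <= eps * h t.
  by near: t; exact: c_sqr_small.
have H2 : (cr t - h t * zr) ^+ 2 + (ci t - h t * zi) ^+ 2 <= (eps / 2 * h t) ^+ 2.
  by near: t; exact: c_asymp.
have H2' : (cr t - h t * zr) * Wr t + (ci t - h t * zi) * Wi t <= eps / 2 * h t * S t.
  apply: le_trans (ler_norm _) _; apply: dot2_le_norm => //.
  by rewrite mulr_ge0// ltW.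
have H3 : zr * Wr t + zi * Wi t <= rho * S t.
  by apply: le_trans (ler_norm _) _; apply: dot2_le_norm => //; rewrite rhoE.
have H4 := ler_wpM2l (h_ge0 t) H3.
have H5 := ler_wpM2r (S_ge0 t) H1.
rewrite S_rec; lra.
Unshelve. all: by end_near. Qed.

Lemma gap_rec t : S t.+1 ^+ 2 - (Wr t.+1 ^+ 2 + Wi t.+1 ^+ 2) =
  (1 - (cr t ^+ 2 + ci t ^+ 2)) ^+ 2 * (S t ^+ 2 - (Wr t ^+ 2 + Wi t ^+ 2)).
Proof. by rewrite S_rec Wr_rec Wi_rec; ring. Qed.

Lemma gap_gt0 t : 0 < S t ^+ 2 - (Wr t ^+ 2 + Wi t ^+ 2).
Proof.
elim: t => [|t IH]; first by rewrite subr_gt0.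
by rewrite gap_rec mulr_gt0// exprn_gt0// subr_gt0.
Qed.

Lemma gap_le_initial t : S t ^+ 2 - (Wr t ^+ 2 + Wi t ^+ 2) <=
  S 0%N ^+ 2 - (Wr 0%N ^+ 2 + Wi 0%N ^+ 2).
Proof.
elim: t => [//|t IH]; apply: le_trans IH; rewrite gap_rec ler_piMl ?(ltW (gap_gt0 t))//.
have c0 : 0 <= cr t ^+ 2 + ci t ^+ 2 by rewrite addr_ge0// sqr_ge0.
by rewrite expr_le1// ?subr_ge0 ?(ltW (c_lt1 t))// gerBl.
Qed.

Hypothesis rho_gt0 : 0 < rho.

Let A t := S t + (zr / rho * Wr t + zi / rho * Wi t).
Let B t := S t - (zr / rho * Wr t + zi / rho * Wi t).
Let G t := S t ^+ 2 - (Wr t ^+ 2 + Wi t ^+ 2).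

Let k_unit : (zr / rho) ^+ 2 + (zi / rho) ^+ 2 = 1 ^+ 2.
Proof.
rewrite !expr_div_n -mulrDl rhoE expr1n divff// expf_neq0// gt_eqF//.
Qed.

Let K_le t : `|zr / rho * Wr t + zi / rho * Wi t| <= S t.
Proof.
by rewrite -[leRHS]mul1r; apply: dot2_le_norm => //; rewrite k_unit.
Qed.

Let A_ge0 t : 0 <= A t.
Proof. by have := K_le t; rewrite ler_norml => /andP[? _]; rewrite /A addrC -lerBlDr sub0r. Qed.

Let B_ge0 t : 0 <= B t.
Proof. by have := K_le t; rewrite ler_norml => /andP[_ ?]; rewrite /B subr_ge0. Qed.

Let G_gt0 t : 0 < G t. Proof. exact: gap_gt0. Qed.

Let G_le_AB t : G t <= A t * B t.
Proof.
have -> : A t * B t = S t ^+ 2 - (zr / rho * Wr t + zi / rho * Wi t) ^+ 2 by rewrite /A /B; ring.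
rewrite lerD2l lerNl opprK -[leRHS]mul1r -(expr1n _ 2%N) -k_unit.
rewrite -subr_ge0.
set k := zr / rho; set l := zi / rho.
have -> : (k ^+ 2 + l ^+ 2) * (Wr t ^+ 2 + Wi t ^+ 2) - (k * Wr t + l * Wi t) ^+ 2 =
  (k * Wi t - l * Wr t) ^+ 2 by ring.
exact: sqr_ge0.
Qed.

Let AB_rec (eps : R) : 0 < eps -> \forall t \near \oo,
  [/\ (1 + 2 * rho * h t) * A t - eps * h t * (A t + B t) <= A t.+1,
      B t.+1 <= (1 - 2 * rho * h t) * B t + eps * h t * (A t + B t) &
      (1 - eps * h t) * G t <= G t.+1].
Proof.
move=> e0.
(* The linearization errors [P1] and [P2], each doubled, and the quadratic terms add up to at most
   [3/2 * eps * h * S]; the allowance is [eps * h * (A + B) = 2 * eps * h * S]. *)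
have e40 : 0 < eps / 4 by rewrite divr_gt0.
near=> t.
have H1 : cr t ^+ 2 + ci t ^+ 2 <= eps / 4 * h t.
  by near: t; exact: c_sqr_small.
have H2 : (cr t - h t * zr) ^+ 2 + (ci t - h t * zi) ^+ 2 <= (eps / 4 * h t) ^+ 2.
  by near: t; exact: c_asymp.
have eh0 : 0 <= eps / 4 * h t by rewrite mulr_ge0// ltW.
have P1 : `|(cr t - h t * zr) * Wr t + (ci t - h t * zi) * Wi t| <= eps / 4 * h t * S t.
  exact: dot2_le_norm.
have P2 : `|zr / rho * (cr t - h t * zr) + zi / rho * (ci t - h t * zi)| <= 1 * (eps / 4 * h t).
  by apply: dot2_le_norm => //; rewrite k_unit.
(* The quadratic part of the step of [W] is [c^2] times the conjugate of [W], of modulus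
   [|c|^2 |W|]. *)
have P3 : `|zr / rho * ((cr t ^+ 2 - ci t ^+ 2) * Wr t + 2 * cr t * ci t * Wi t) +
     zi / rho * (2 * cr t * ci t * Wr t - (cr t ^+ 2 - ci t ^+ 2) * Wi t)| <=
     1 * ((cr t ^+ 2 + ci t ^+ 2) * S t).
  apply: dot2_le_norm => //; rewrite ?k_unit//.
    by rewrite mulr_ge0// addr_ge0// sqr_ge0.
  rewrite [leRHS]exprMn.
  have -> : ((cr t ^+ 2 - ci t ^+ 2) * Wr t + 2 * cr t * ci t * Wi t) ^+ 2 +
    (2 * cr t * ci t * Wr t - (cr t ^+ 2 - ci t ^+ 2) * Wi t) ^+ 2 =
    (cr t ^+ 2 + ci t ^+ 2) ^+ 2 * (Wr t ^+ 2 + Wi t ^+ 2) by ring.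
  by rewrite ler_wpM2l// sqr_ge0.
have P4 := ler_wpM2r (S_ge0 t) H1.
have k2 : zr / rho * zr + zi / rho * zi = rho.
  have -> : zr / rho * zr + zi / rho * zi = (zr ^+ 2 + zi ^+ 2) / rho by ring.
  by rewrite rhoE expr2 mulfK// gt_eqF.
have zrE : zr = rho * (zr / rho) by rewrite mulrC divfK// gt_eqF.
have ziE : zi = rho * (zi / rho) by rewrite mulrC divfK// gt_eqF.
have P5 : (zr * Wr t + zi * Wi t) = rho * (zr / rho * Wr t + zi / rho * Wi t).
  by rewrite {1}zrE {1}ziE; ring.
move: P1 P2 P3; rewrite !ler_norml !mul1r => /andP[P1 P1'] /andP[P2 P2'] /andP[P3 P3'].
have P2S := ler_wpM2r (S_ge0 t) P2; have P2S' := ler_wpM2r (S_ge0 t) P2'.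
rewrite /A /B.
have P5h : h t * (zr * Wr t + zi * Wi t) = h t * (rho * (zr / rho * Wr t + zi / rho * Wi t)).
  by rewrite P5.
have k2S : (zr / rho * zr + zi / rho * zi) * (h t * S t) = rho * (h t * S t) by rewrite k2.
have C0 : 0 <= (cr t ^+ 2 + ci t ^+ 2) * S t by rewrite mulr_ge0// addr_ge0// sqr_ge0.
split.
- rewrite S_rec Wr_rec Wi_rec.
  move: (zr / rho) (zi / rho) P2S P2S' P3 P3' P5h k2S => k l *; lra.
- rewrite S_rec Wr_rec Wi_rec.
  move: (zr / rho) (zi / rho) P2S P2S' P3 P3' P5h k2S => k l *; lra.
rewrite {2}/G gap_rec -/(G t).
rewrite ler_wpM2r// ?(ltW (G_gt0 t))//.
have := sqr_ge0 (cr t ^+ 2 + ci t ^+ 2).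
have : 0 <= cr t ^+ 2 + ci t ^+ 2 by rewrite addr_ge0// sqr_ge0.
move: (cr t ^+ 2 + ci t ^+ 2) H1 => q *; nra.
Unshelve. all: by end_near. Qed.

(** With [K] the component of [W] along the limit phase, [S - K <= eps / 2 * (S + K)] and [K <= S]
    give [S - K <= eps * S]. *)
Lemma phase_alignment (eps : R) : 0 < eps -> \forall t \near \oo,
  (1 - eps) * (rho * S t) <= zr * Wr t + zi * Wi t.
Proof.
move=> e0.
have e20 : 0 < eps / 2 by rewrite divr_gt0.
have := expanding_direction_dominates R h h_ge0 rho A B G h_div h_cvg0 rho_gt0
  A_ge0 B_ge0 G_gt0 G_le_AB AB_rec (eps / 2) e20.
apply: filterS => t HB.
have -> : zr * Wr t + zi * Wi t = rho * (zr / rho * Wr t + zi / rho * Wi t).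
  have nz : rho != 0 by rewrite gt_eqF.
  by field.
rewrite mulrCA ler_wpM2l//.
have := K_le t; rewrite ler_norml => /andP[_].
move: HB; rewrite /A /B; set K := zr / rho * Wr t + zi / rho * Wi t => HB KS.
have := mulr_ge0 (ltW e0) (_ : 0 <= S t - K); rewrite subr_ge0 => /(_ KS); lra.
Qed.

(** The growing quantity is [rho * A] with the section-local [A] unfolded. Once [B <= A], the error
    [eps * h * (A + B)] costs at most [2 * eps * h * A]. *)
Lemma S_growth_ge (eps : R) : 0 < eps -> \forall t \near \oo,
  (1 + 2 * (rho - eps) * h t) * (rho * S t + (zr * Wr t + zi * Wi t)) <=
  rho * S t.+1 + (zr * Wr t.+1 + zi * Wi t.+1).
Proof.
move=> e0.
have AE t : rho * S t + (zr * Wr t + zi * Wi t) = rho * A t.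
  have nz : rho != 0 by rewrite gt_eqF.
  by rewrite /A; field.
near=> t.
have HB : B t <= 1 * A t.
  near: t; exact: (expanding_direction_dominates R h h_ge0 rho A B G h_div h_cvg0 rho_gt0
  A_ge0 B_ge0 G_gt0 G_le_AB AB_rec).
have [HA _ _] : [/\ (1 + 2 * rho * h t) * A t - eps * h t * (A t + B t) <= A t.+1,
      B t.+1 <= (1 - 2 * rho * h t) * B t + eps * h t * (A t + B t) &
      (1 - eps * h t) * G t <= G t.+1] by near: t; exact: AB_rec.
rewrite !AE mulrCA ler_wpM2l//.
apply: le_trans HA.
have eh0 : 0 <= eps * h t by rewrite mulr_ge0// ltW.
have := ler_wpM2l eh0 HB; lra.
Unshelve. all: by end_near. Qed.

End FrequencyDynamics.

(** * Real form of the discrete Fourier transform *)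

Section Fourier.
Variables (R : realType) (D : nat).
Implicit Types (x w v z : 'rV[R]_D) (d e k : 'I_D) (u : 'rV[R]_(D + D)).

(** The position [p] is a natural number, so that an unreduced sum of positions can be compared with
    its residue modulo [D]. *)
Definition ang d (p : nat) : R := 2 * pi * (p%:R * d%:R) / D%:R.

Lemma dft_reE w d : dft_re w d =
  (Num.sqrt D%:R)^-1 * \sum_(p < D) w 0 p * cos (ang d p).
Proof. by []. Qed.

Lemma dft_imE w d : dft_im w d =
  - ((Num.sqrt D%:R)^-1 * \sum_(p < D) w 0 p * sin (ang d p)).
Proof. by []. Qed.

Lemma natD_neq0 d : D%:R != 0 :> R.
Proof. by rewrite pnatr_eq0 -lt0n (ord_pos d). Qed.

Lemma sqrtD_neq0 d : Num.sqrt D%:R != 0 :> R.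
Proof. by rewrite gt_eqF// sqrtr_gt0 ltr0n (ord_pos d). Qed.

Lemma addmodIC d e : addmodI d e = addmodI e d.
Proof. by apply: val_inj; rewrite /= addnC. Qed.

Lemma addmodI_inj d : injective (addmodI d).
Proof.
move=> e k /(congr1 val) /= /eqP; rewrite eqn_modDl => /eqP.
by rewrite !modn_small// => /val_inj.
Qed.

Lemma ang_addmod d e k : ang d (e + k)%N = ang d (addmodI e k) + pi *+ 2 *+ ((e + k) %/ D * d).
Proof.
rewrite /ang {1}(divn_eq (e + k) D) /= natrD natrM.
rewrite -[pi *+ 2 *+ _]mulr_natr natrM -[pi *+ 2]mulr_natl.
by field; exact: natD_neq0.
Qed.

Lemma angD d p q : ang d (p + q)%N = ang d p + ang d q.
Proof. by rewrite /ang natrD; ring. Qed.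

Lemma cos_addmod d e k : cos (ang d (addmodI e k)) =
  cos (ang d e) * cos (ang d k) - sin (ang d e) * sin (ang d k).
Proof. by rewrite -cosD -angD ang_addmod periodicn//; exact: cosD2pi. Qed.

Lemma sin_addmod d e k : sin (ang d (addmodI e k)) =
  sin (ang d e) * cos (ang d k) + cos (ang d e) * sin (ang d k).
Proof. by rewrite -sinD -angD ang_addmod periodicn//; exact: sinD2pi. Qed.

(** The shift theorem in real form: after reindexing the right-hand sums by the shift, the addition
    formulas and [cos^2 + sin^2 = 1] undo the rotation. *)
Lemma cos_sum_shift d k z : \sum_(e < D) cos (ang d e) * z 0 (addmodI k e) =
  cos (ang d k) * \sum_(e < D) z 0 e * cos (ang d e) + sin (ang d k) * \sum_(e < D) z 0 e * sin (ang d e).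
Proof.
rewrite [X in _ = _ * X + _](reindex_inj (addmodI_inj k)).
rewrite [X in _ = _ + _ * X](reindex_inj (addmodI_inj k))/=.
rewrite !mulr_sumr -big_split /=; apply: eq_bigr => e _.
rewrite cos_addmod sin_addmod.
have := cos2Dsin2 (ang d k); set c := cos (ang d k); set s := sin (ang d k) => cs.
transitivity ((c ^+ 2 + s ^+ 2) * cos (ang d e) * z 0 (addmodI k e)); last by ring.
by rewrite cs mul1r.
Qed.

Lemma sin_sum_shift d k z : \sum_(e < D) sin (ang d e) * z 0 (addmodI k e) =
  cos (ang d k) * \sum_(e < D) z 0 e * sin (ang d e) - sin (ang d k) * \sum_(e < D) z 0 e * cos (ang d e).
Proof.
rewrite [X in _ = _ * X - _](reindex_inj (addmodI_inj k)).
rewrite [X in _ = _ - _ * X](reindex_inj (addmodI_inj k))/=.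
rewrite !mulr_sumr -sumrB; apply: eq_bigr => e _.
rewrite cos_addmod sin_addmod.
have := cos2Dsin2 (ang d k); set c := cos (ang d k); set s := sin (ang d k) => cs.
transitivity ((c ^+ 2 + s ^+ 2) * sin (ang d e) * z 0 (addmodI k e)); last by ring.
by rewrite cs mul1r.
Qed.

(** [cconv] adds the summation index, hence is a correlation: its transform is that of [z] times the
    conjugate of that of [v], and the factors [1 / sqrt D] match exactly. *)
Lemma dft_re_cconv z v d :
  dft_re (cconv z v) d = dft_re z d * dft_re v d + dft_im z d * dft_im v d.
Proof.
rewrite !dft_reE !dft_imE.
set s := (Num.sqrt D%:R)^-1.
transitivity (s * (s * \sum_(k < D) v 0 k * (cos (ang d k) * \sum_(e < D) z 0 e * cos (ang d e)
   + sin (ang d k) * \sum_(e < D) z 0 e * sin (ang d e)))).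
  congr (_ * _).
  under eq_bigr do rewrite mxE -/s -mulrA mulr_suml.
  rewrite -mulr_sumr exchange_big/=; congr (_ * _); apply: eq_bigr => k _.
  rewrite -cos_sum_shift mulr_sumr; apply: eq_bigr => e _.
  by rewrite addmodIC -/(ang d e); ring.
under eq_bigr do rewrite mulrDr !mulrA.
rewrite big_split/= -!mulr_suml; ring.
Qed.

Lemma dft_im_cconv z v d :
  dft_im (cconv z v) d = dft_im z d * dft_re v d - dft_re z d * dft_im v d.
Proof.
rewrite !dft_reE !dft_imE.
set s := (Num.sqrt D%:R)^-1.
transitivity (- (s * (s * \sum_(k < D) v 0 k * (cos (ang d k) * \sum_(e < D) z 0 e * sin (ang d e)
   - sin (ang d k) * \sum_(e < D) z 0 e * cos (ang d e))))).
  congr (- (_ * _)).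
  under eq_bigr do rewrite mxE -/s -mulrA mulr_suml.
  rewrite -mulr_sumr exchange_big/=; congr (_ * _); apply: eq_bigr => k _.
  rewrite -sin_sum_shift mulr_sumr; apply: eq_bigr => e _.
  by rewrite addmodIC -/(ang d e); ring.
under eq_bigr do rewrite mulrBr !mulrA.
rewrite sumrB/= -!mulr_suml; ring.
Qed.

Lemma fconvE u x : fconv u x = (Num.sqrt D%:R)^-1 *
  \sum_(e < D) \sum_(k < D) lsubmx u 0 k * rsubmx u 0 e * x 0 (addmodI e k).
Proof.
rewrite /fconv /dot mulr_sumr; apply: eq_bigr => e _.
rewrite [cconv _ _ _ _]mxE -mulrA mulr_suml; congr (_ * _); apply: eq_bigr => k _; ring.
Qed.

Lemma fconv_sym u x : fconv u x = dot (cconv x (rsubmx u)) (lsubmx u).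
Proof.
rewrite fconvE exchange_big/= /dot mulr_sumr; apply: eq_bigr => e _.
rewrite [cconv _ _ _ _]mxE -mulrA mulr_suml; congr (_ * _); apply: eq_bigr => k _.
by rewrite addmodIC; ring.
Qed.

(** [xget] returns an element of the defining set as soon as there is one; by linearity in [x], the
    values of [fconv u] on the unit vectors form such an element. *)
Lemma PconvP u x : fconv u x = dot x (Pconv u).
Proof.
rewrite /Pconv; move: x; apply: (@xgetPex _ 0 [set w | forall x, fconv u x = dot x w]).
exists (\row_p fconv u (delta_mx 0 p)) => x /=.
rewrite fconvE /dot.
under [RHS]eq_bigr do rewrite mxE fconvE mulrCA.
rewrite -mulr_sumr; congr (_ * _).
under [RHS]eq_bigr do rewrite mulr_sumr.
rewrite [RHS]exchange_big/=; apply: eq_bigr => e _.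
under [RHS]eq_bigr do rewrite mulr_sumr.
rewrite [RHS]exchange_big/=; apply: eq_bigr => k _.
rewrite (bigD1 (addmodI e k))//= big1 ?addr0; last first.
  by move=> p pk; rewrite [delta_mx _ _ _ _]mxE eqxx andTb eq_sym (negbTE pk) !mulr0.
by rewrite [delta_mx _ _ _ _]mxE !eqxx mulr1 mulrC.
Qed.

(** A Fourier coefficient of [Pconv u] is a pairing with a cosine or sine vector, hence a value of
    [fconv u], where the addition formulas separate the two layers. *)
Lemma dft_re_Pconv u d : dft_re (Pconv u) d =
  dft_re (lsubmx u) d * dft_re (rsubmx u) d - dft_im (lsubmx u) d * dft_im (rsubmx u) d.
Proof.
have -> : dft_re (Pconv u) d = (Num.sqrt D%:R)^-1 * fconv u (\row_p cos (ang d p)).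
  rewrite PconvP dft_reE /dot; congr (_ * _); apply: eq_bigr => p _.
  by rewrite mxE mulrC.
rewrite fconvE !dft_reE !dft_imE; set s := (Num.sqrt D%:R)^-1.
transitivity (s * (s * \sum_(e < D) (rsubmx u 0 e * cos (ang d e) * (\sum_(k < D) lsubmx u 0 k * cos (ang d k))
   - rsubmx u 0 e * sin (ang d e) * (\sum_(k < D) lsubmx u 0 k * sin (ang d k))))).
  do 2 congr (_ * _); apply: eq_bigr => e _.
  rewrite !mulr_sumr -sumrB; apply: eq_bigr => k _.
  by rewrite [X in _ * X]mxE cos_addmod; ring.
by rewrite sumrB -!mulr_suml; ring.
Qed.

Lemma dft_im_Pconv u d : dft_im (Pconv u) d =
  dft_re (lsubmx u) d * dft_im (rsubmx u) d + dft_im (lsubmx u) d * dft_re (rsubmx u) d.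
Proof.
have -> : dft_im (Pconv u) d = - ((Num.sqrt D%:R)^-1 * fconv u (\row_p sin (ang d p))).
  rewrite PconvP dft_imE /dot; congr (- (_ * _)); apply: eq_bigr => p _.
  by rewrite mxE mulrC.
rewrite fconvE !dft_reE !dft_imE; set s := (Num.sqrt D%:R)^-1.
transitivity (- (s * (s * \sum_(e < D) (rsubmx u 0 e * sin (ang d e) * (\sum_(k < D) lsubmx u 0 k * cos (ang d k))
   + rsubmx u 0 e * cos (ang d e) * (\sum_(k < D) lsubmx u 0 k * sin (ang d k)))))).
  congr (- _); do 2 congr (_ * _); apply: eq_bigr => e _.
  rewrite !mulr_sumr -big_split/=; apply: eq_bigr => k _.
  by rewrite [X in _ * X]mxE sin_addmod; ring.
by rewrite big_split -!mulr_suml/=; ring.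
Qed.

Lemma cos_neq1 (y : R) : 0 < y < pi *+ 2 -> cos y != 1.
Proof.
move=> /andP[y0 ypi].
have s0 : 0 < sin (y / 2).
  by apply: sin_gt0_pi; rewrite divr_gt0//= ltr_pdivrMr// mulr_natr.
have -> : y = y / 2 + y / 2 by rewrite -splitr.
rewrite cosD -!expr2; have := cos2Dsin2 (y / 2).
move: (sin _) s0 (cos _) => s s0 c cs.
by rewrite lt_eqF//; nra.
Qed.

Lemma sum_cos_sin (y : R) : sin (D%:R * y) = 0 -> cos (D%:R * y) = 1 -> cos y != 1 ->
  \sum_(d < D) cos (d%:R * y) = 0 /\ \sum_(d < D) sin (d%:R * y) = 0.
Proof.
move=> sD cD cy.
pose C n := \sum_(d < n) cos (d%:R * y); pose S n := \sum_(d < n) sin (d%:R * y).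
(* The real and imaginary parts of the geometric sum identity: multiplying the sum of the
   [e^{i d y}] by [e^{i y}] adds [e^{i n y} - 1]. *)
have H n : cos y * C n - sin y * S n = C n + cos (n%:R * y) - 1 /\
           sin y * C n + cos y * S n = S n + sin (n%:R * y).
  elim: n => [|n [IH1 IH2]].
    by rewrite /C /S !big_ord0 mul0r cos0 sin0; split; ring.
  rewrite /C /S !big_ord_recr/= -/(C n) -/(S n) !mulrDr -natr1 mulrDl mul1r cosD sinD.
  by split; lra.
have := H D; rewrite sD cD -/(C D) -/(S D); move: (C D) (S D) => c s [H1 H2].
have e := cos2Dsin2 y.
have nz : (1 - cos y) != 0 by rewrite subr_eq0 eq_sym.
have E1 : (1 - cos y) * c = 0 - sin y * s by lra.
have E2 : (1 - cos y) * s = sin y * c by lra.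
(* The factor comes from [|1 - e^{i y}|^2 = 2 * (1 - cos y)]. *)
have c0 : (1 - cos y) * (2 * c) = 0.
  have : (1 - cos y) * ((1 - cos y) * c) = - (sin y * (sin y * c)).
    by rewrite E1 -E2; ring.
  nra.
have s0 : (1 - cos y) * (2 * s) = 0.
  have : (1 - cos y) * ((1 - cos y) * s) = - (sin y * (sin y * s)).
    rewrite E2; have : sin y * s = - ((1 - cos y) * c) by rewrite E1; ring.
    by move=> ->; ring.
  nra.
move/eqP: c0; move/eqP: s0; rewrite !mulf_eq0 (negbTE nz) pnatr_eq0/= => /eqP-> /eqP->.
by [].
Qed.

Lemma dft_orthogonality d e : \sum_(k < D) cos (ang k d - ang k e) = if d == e then D%:R else 0.
Proof.
have [->|de] := eqVneq.
  by under eq_bigr do rewrite subrr cos0; rewrite sumr_const card_ord.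
wlog lt_ed : d e de / (e < d)%N.
  move=> W; have := de; rewrite neq_ltn => /orP[ed|]; last exact: W.
  rewrite -[RHS](W e d) 1?eq_sym//; apply: eq_bigr => k _.
  by rewrite -cosN opprB.
pose y : R := 2 * pi * (d - e)%:R / D%:R.
have D0 := natD_neq0 d.
have Dy : D%:R * y = pi *+ 2 *+ (d - e).
  by rewrite /y -[RHS]mulr_natr -[pi *+ 2]mulr_natl mulrC divfK.
have -> : \sum_(k < D) cos (ang k d - ang k e) = \sum_(k < D) cos (k%:R * y).
  apply: eq_bigr => k _; congr cos.
  rewrite /ang /y natrB 1?ltnW//; by field.
apply: (proj1 (sum_cos_sin y _ _ _)).
- by rewrite Dy -[X in sin X]add0r periodicn ?sin0//; exact: sinD2pi.
- by rewrite Dy -[X in cos X]add0r periodicn ?cos0//; exact: cosD2pi.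
apply: cos_neq1; rewrite /y.
have pi0 := pi_gt0 R.
have Dp : 0 < D%:R :> R by rewrite ltr0n (ord_pos d).
apply/andP; split; first by rewrite divr_gt0// !mulr_gt0// ltr0n subn_gt0.
rewrite ltr_pdivrMr// -[pi *+ 2]mulr_natl.
by rewrite ltr_pM2l ?mulr_gt0// ltr_nat (leq_ltn_trans (leq_subr _ _)).
Qed.

Lemma parseval x w : dot x w = \sum_(d < D) (dft_re x d * dft_re w d + dft_im x d * dft_im w d).
Proof.
under [RHS]eq_bigr do rewrite !dft_reE !dft_imE.
set s := (Num.sqrt D%:R)^-1.
transitivity (s ^+ 2 * \sum_(d < D) \sum_(p < D) \sum_(q < D) x 0 p * w 0 q * cos (ang d p - ang d q)); last first.
  rewrite mulr_sumr; apply: eq_bigr => d _.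
  transitivity (s ^+ 2 * ((\sum_(p < D) x 0 p * cos (ang d p)) * (\sum_(q < D) w 0 q * cos (ang d q))
     + (\sum_(p < D) x 0 p * sin (ang d p)) * (\sum_(q < D) w 0 q * sin (ang d q)))); last by ring.
  congr (_ * _); rewrite !mulr_suml -big_split/=; apply: eq_bigr => p _.
  rewrite !mulr_sumr -big_split/=; apply: eq_bigr => q _.
  by rewrite cosB; ring.
rewrite exchange_big/= /dot mulr_sumr; apply: eq_bigr => p _.
rewrite exchange_big/= (bigD1 p)//= [X in _ + X]big1 ?addr0; last first.
  by move=> q qp; rewrite -mulr_sumr dft_orthogonality eq_sym (negbTE qp) mulr0.
rewrite -mulr_sumr dft_orthogonality eqxx /s exprVn sqr_sqrtr ?ler0n//.
by field; exact: natD_neq0.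
Qed.

Lemma dft_reD x w (a : R) d : dft_re (x + a *: w) d = dft_re x d + a * dft_re w d.
Proof.
rewrite /dft_re mulrCA -mulrDr; congr (_ * _); rewrite mulr_sumr -big_split/=.
by apply: eq_bigr => p _; rewrite !mxE; ring.
Qed.

Lemma dft_imD x w (a : R) d : dft_im (x + a *: w) d = dft_im x d + a * dft_im w d.
Proof.
rewrite /dft_im mulrN mulrCA -opprD -mulrDr; congr (- (_ * _)); rewrite mulr_sumr -big_split/=.
by apply: eq_bigr => p _; rewrite !mxE; ring.
Qed.

Lemma dft_reZ w (a : R) d : dft_re (a *: w) d = a * dft_re w d.
Proof.
rewrite /dft_re mulrCA; congr (_ * _); rewrite mulr_sumr.
by apply: eq_bigr => p _; rewrite !mxE; ring.
Qed.

Lemma dft_imZ w (a : R) d : dft_im (a *: w) d = a * dft_im w d.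
Proof.
rewrite /dft_im mulrN mulrCA; congr (- (_ * _)); rewrite mulr_sumr.
by apply: eq_bigr => p _; rewrite !mxE; ring.
Qed.

Lemma dft_abs_ge0 w d : 0 <= dft_abs w d. Proof. exact: sqrtr_ge0. Qed.

Lemma dft_abs_sqr w d : dft_abs w d ^+ 2 = dft_re w d ^+ 2 + dft_im w d ^+ 2.
Proof. by rewrite sqr_sqrtr// addr_ge0// sqr_ge0. Qed.

Lemma dft_absZ w (a : R) d : 0 <= a -> dft_abs (a *: w) d = a * dft_abs w d.
Proof.
move=> a0; rewrite /dft_abs dft_reZ dft_imZ !exprMn -mulrDr sqrtrM ?sqr_ge0//.
by rewrite sqrtr_sqr ger0_norm.
Qed.

Lemma fourier_l1Z w (a : R) : 0 <= a -> fourier_l1 (a *: w) = a * fourier_l1 w.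
Proof.
by move=> a0; rewrite /fourier_l1 mulr_sumr; apply: eq_bigr => d _; rewrite dft_absZ.
Qed.

(** Duality between the maximum norm and the l1 norm of the transforms, which makes any vector a
    lower bound for [fourier_l1]; equality characterizes the certificate sought. *)
Lemma dot_le_fourier_l1 x w (M : R) : (forall d, dft_abs x d <= M) ->
  dot x w <= M * fourier_l1 w.
Proof.
move=> xM; rewrite parseval /fourier_l1 mulr_sumr; apply: ler_sum => d _.
apply: (@le_trans _ _ (dft_abs x d * dft_abs w d)); last first.
  by rewrite ler_wpM2r// dft_abs_ge0.
apply: le_trans (ler_norm _) _; apply: dot2_le_norm; rewrite ?dft_abs_ge0// dft_abs_sqr//.
Qed.

End Fourier.

(** * Null sets by covers with boxes *)

Section NullSets.
Variable R : realType.

(** Jordan content zero: the covers are finite, so that countably many of them can be concatenated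
    into the one sequence of boxes that [leb_null] asks for. *)
Definition content_zero n (A : set 'rV[R]_n) : Prop :=
  forall eps : R, 0 < eps -> exists s : seq ('rV[R]_n * 'rV[R]_n),
    [/\ (forall b, b \in s -> forall j, b.1 0 j <= b.2 0 j),
        (forall x, A x -> exists2 b, b \in s & in_box b.1 b.2 x) &
        \sum_(b <- s) box_vol b.1 b.2 < eps].

Lemma box_volE n (lo hi : 'rV[R]_n) : box_vol lo hi = \prod_(j < n) (hi 0 j - lo 0 j).
Proof. by rewrite /box_vol big_ord1. Qed.

Lemma box_vol_ge0 n (lo hi : 'rV[R]_n) :
  (forall j, lo 0 j <= hi 0 j) -> 0 <= box_vol lo hi.
Proof. by move=> H; rewrite box_volE; apply: prodr_ge0 => j _; rewrite subr_ge0. Qed.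

Lemma leb_null_countable_content_zero n (I : countType) (A : I -> set 'rV[R]_n.+1) :
  (forall i, content_zero _ (A i)) -> leb_null [set x | exists i, A i x].
Proof.
move=> Anull eps e0.
pose AA k : set 'rV[R]_n.+1 := if unpickle k is Some i then A i else set0.
have AAnull k : content_zero _ (AA k).
  rewrite /AA; case: unpickle => [i|//] ; first exact: Anull.
  by move=> e he; exists [::]; split => //; rewrite big_nil.
have /choice[s Hs] k : exists s : seq ('rV[R]_n.+1 * 'rV[R]_n.+1),
    [/\ (forall b, b \in s -> forall j, b.1 0 j <= b.2 0 j),
        (forall x, AA k x -> exists2 b, b \in s & in_box b.1 b.2 x),
        \sum_(b <- s) box_vol b.1 b.2 < eps / 2 ^+ k.+1 & (0 < size s)%N].
  have [|s [s1 s2 s3]] := AAnull k (eps / 2 ^+ k.+1).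
    by rewrite divr_gt0// exprn_gt0.
  (* A degenerate box makes every list nonempty, so the first [k + 1] lists contain at least [k + 1]
     boxes; its volume is 0 because the dimension is positive. *)
  exists ((0, 0) :: s); split => //.
  - by move=> b; rewrite in_cons => /orP[/eqP->//|/s1].
  - by move=> x /s2[b bs bx]; exists b => //; rewrite in_cons bs orbT.
  - rewrite big_cons box_volE (bigD1 ord0)//= subrr mul0r add0r//.
pose F K := flatten [seq s k | k <- iota 0 K].
have FS K : F K.+1 = F K ++ s K.
  by rewrite /F -[K.+1]addn1 iotaD map_cat flatten_cat/= cats0 add0n.
have sizeF K : (K <= size (F K))%N.
  elim: K => // K IH; rewrite FS size_cat -[K.+1]addn1 leq_add//.
  by have [] := Hs K.
have Fpre K k j : (j < size (F K))%N -> nth (0, 0) (F (K + k)%N) j = nth (0, 0) (F K) j.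
  move=> jK; have: (size (F K) <= size (F (K + k)%N))%N /\
     nth (0, 0) (F (K + k)%N) j = nth (0, 0) (F K) j; last by case.
  elim: k => [|k [IH1 IH2]]; first by rewrite addn0.
  by rewrite addnS FS size_cat nth_cat (leq_trans jK IH1) IH2 (leq_trans IH1) ?leq_addr.
have Fval K b : b \in F K -> forall j, b.1 0 j <= b.2 0 j.
  move=> /flattenP[_ /mapP[k _ ->] bk] j.
  by have [H _ _ _] := Hs k; exact: H.
(* The finite concatenations are prefixes of each other, so the [k]-th box does not depend on which
   long enough concatenation it is read from. *)
pose f k := nth (0, 0) (F k.+1) k.
have fE K k : (k < K)%N -> f k = nth (0, 0) (F K) k.
  move=> kK; rewrite /f -[in RHS](subnKC kK) Fpre//.
have fin k : f k \in F k.+1 by rewrite mem_nth.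
exists (fun k => (f k).1), (fun k => (f k).2); split; [|split].
- by move=> k i j; rewrite ord1; apply: Fval (fin k) _.
- move=> x [i Ai].
  have [_ + _ _] := Hs (pickle i) => /(_ x).
  rewrite /AA pickleK => /(_ Ai)[b bs bx].
  have bF : b \in F (pickle i).+1 by rewrite FS mem_cat bs orbT.
  exists (index b (F (pickle i).+1)).
  suff -> : f (index b (F (pickle i).+1)) = b by [].
  have ib : (index b (F (pickle i).+1) < size (F (pickle i).+1))%N by rewrite index_mem.
  rewrite -[RHS](nth_index (0, 0) bF).
  move: (index _ _) ib => j jF.
  have [jK|Kj] := ltnP j (pickle i).+1; first exact: fE.
  by rewrite /f -(subnKC (leqW Kj)) Fpre.
move=> K.
have bnd L : \sum_(b <- F L) box_vol b.1 b.2 <= eps * (1 - 2 ^- L).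
  elim: L => [|L IH]; first by rewrite big_nil expr0 invr1 subrr mulr0.
  rewrite FS big_cat/=.
  have [_ _ /ltW H _] := Hs L.
  apply: (le_trans (lerD IH H)).
  rewrite exprS invfM.
  by move: (2 ^- L) => q; lra.
apply: (@le_lt_trans _ _ (eps * (1 - 2 ^- K))); last first.
  by rewrite gtr_pMr// gtrBl invr_gt0 exprn_gt0.
apply: le_trans (bnd K).
rewrite [leRHS](big_nth (0, 0)) (big_cat_nat (leq0n K) (sizeF K))/= big_mkord.
rewrite (eq_bigr (fun i : 'I_K => box_vol (nth (0, 0) (F K) i).1 (nth (0, 0) (F K) i).2)).
  rewrite lerDl big_nat_cond sumr_ge0// => i; rewrite andbT => /andP[_ iF].
  by apply: box_vol_ge0; apply: Fval (mem_nth _ iF).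
by move=> i _; rewrite (fE K).
Qed.

Lemma grid_cell (k : nat) (w y : R) : 0 <= y -> y <= k.+1%:R * w ->
  exists c : 'I_k.+1, c%:R * w <= y <= c.+1%:R * w.
Proof.
move=> y0 yk.
have ex : exists c, y <= c.+1%:R * w by exists k.
have [c yc cmin] := ex_minnP ex.
have ck : (c < k.+1)%N by rewrite ltnS cmin.
exists (Ordinal ck); rewrite /= yc andbT.
case: c yc cmin ck => [|c] yc cmin ck; first by rewrite mul0r.
rewrite leNgt; apply/negP => /ltW/cmin.
by rewrite ltnn.
Qed.

(** The last hypothesis says that on [A] the coordinate [j0] is a uniformly continuous function of
    the others; over each grid cell of these, one box of height [2 * kappa] covers [A]. *)
Lemma content_zero_graph n (j0 : 'I_n) (m : R) (A : set 'rV[R]_n) : 0 < m ->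
  (forall x, A x -> forall j, `|x 0 j| <= m) ->
  (forall kappa : R, 0 < kappa -> exists2 delta : R, 0 < delta &
     forall x x', A x -> A x' -> (forall j, j != j0 -> `|x 0 j - x' 0 j| <= delta) ->
       `|x 0 j0 - x' 0 j0| <= kappa) ->
  content_zero _ A.
Proof.
move=> m0 Am Acont eps e0.
pose V : R := \prod_(j < n | j != j0) (2 * m).
have V0 : 0 < V by apply: prodr_gt0 => j _; rewrite mulr_gt0.
(* The base has volume [V], so the boxes of height [2 * kappa] have total volume [eps / 2]. *)
pose kappa := eps / (4 * V).
have kappa0 : 0 < kappa by rewrite divr_gt0// mulr_gt0.
have [delta delta0 Hd] := Acont _ kappa0.
have [k Hk] : exists k : nat, 2 * m / k.+1%:R <= delta.
  exists (Num.truncn (2 * m / delta)); rewrite ler_pdivrMr// [leRHS]mulrC -ler_pdivrMr//.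
  by rewrite ltW// truncnS_gt.
pose w := 2 * m / k.+1%:R.
have w0 : 0 < w by rewrite divr_gt0// mulr_gt0.
pose cell (c : {ffun 'I_n -> 'I_k.+1}) : set 'rV[R]_n := [set x |
  forall j, j != j0 -> - m + (c j)%:R * w <= x 0 j <= - m + (c j).+1%:R * w].
(* The height of a sample point of [A] over the cell; over cells that [A] misses, a default
   value. *)
pose tau c : R := xget 0 [set x | A x /\ cell c x] 0 j0.
pose lo (c : {ffun 'I_n -> 'I_k.+1}) : 'rV[R]_n :=
  \row_j if j == j0 then tau c - kappa else - m + (c j)%:R * w.
pose hi (c : {ffun 'I_n -> 'I_k.+1}) : 'rV[R]_n :=
  \row_j if j == j0 then tau c + kappa else - m + (c j).+1%:R * w.
(* Fixing the index at [j0] counts every cell of the remaining coordinates once, and the sum over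
   cells still factors as a product over coordinates. *)
pose Q (j : 'I_n) : pred 'I_k.+1 := [pred c | (j != j0) || (c == ord0)].
exists [seq (lo c, hi c) | c <- enum (family Q)]; split.
- move=> _ /mapP[c _ ->] j; rewrite !mxE; case: ifP => _ /=.
    by rewrite lerD2l; lra.
  by rewrite lerD2l ler_wpM2r ?(ltW w0)// ler_nat.
- move=> x Ax.
  have /fin_all_exists[c Hc] (j : 'I_n) : exists c : 'I_k.+1,
      if j == j0 then c == ord0 else - m + c%:R * w <= x 0 j <= - m + c.+1%:R * w.
    case: (j == j0); first by exists ord0.
    have := Am x Ax j; rewrite ler_norml => /andP[x1 x2].
    have [||c /andP[c1 c2]] := grid_cell k w (x 0 j + m).
    - by rewrite -lerBlDr sub0r.
    - by rewrite /w mulrC divfK ?pnatr_eq0//; lra.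
    by exists c; apply/andP; split; lra.
  pose cc := [ffun j => c j].
  have xcell : cell cc x.
    by move=> j /negbTE jj0; rewrite ffunE; have := Hc j; rewrite jj0.
  exists (lo cc, hi cc).
    apply/mapP; exists cc => //; rewrite mem_enum; apply/familyP => j.
    rewrite ffunE inE /=; have := Hc j; case: eqP => //= _ ->.
  have [Ax' cx'] := @xgetPex _ 0 [set x | A x /\ cell cc x] (ex_intro _ x (conj Ax xcell)).
  move=> i j; rewrite ord1 !mxE /=; case: eqP => [->|/eqP jj0]; last exact: xcell.
  rewrite -ler_distl; apply: Hd => // j' jj0'.
  have := xcell _ jj0'; have := cx' _ jj0'.
  rewrite -natr1 mulrDl mul1r => /andP[y1 y2] /andP[z1 z2].
  apply: le_trans Hk; rewrite -/w ler_norml; apply/andP; split; lra.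
rewrite big_map big_enum/=.
have -> : \sum_(c in family Q) box_vol (lo c) (hi c) =
   \sum_(c in family Q) \prod_(j < n) (if j == j0 then 2 * kappa else w).
  apply: eq_bigr => c _; rewrite box_volE; apply: eq_bigr => j _.
  rewrite !mxE; case: ifP => _; first by ring.
  by rewrite -natr1; ring.
rewrite -(bigA_distr_big_dep Q (fun j (_ : 'I_k.+1) => if j == j0 then 2 * kappa else w)).
rewrite (bigD1 j0)//= eqxx (big_pred1 ord0); last by move=> c; rewrite /Q inE eqxx.
have -> : \prod_(j < n | j != j0) \sum_(c | Q j c) (if j == j0 then 2 * kappa else w) = V.
  apply: eq_bigr => j jj0; rewrite (negbTE jj0).
  rewrite (eq_bigl predT) => [|c]; last by rewrite /Q inE jj0.
  by rewrite sumr_const card_ord -[LHS]mulr_natr divfK// pnatr_eq0.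
rewrite /kappa invfM.
have -> : 2 * (eps * (4^-1 * V^-1)) * V = eps / 2.
  have nz := lt0r_neq0 V0; by field.
by rewrite ltr_pdivrMr// ltr_pMr// ltr1n.
Qed.

Lemma sqrt_dist (a b : R) : `|Num.sqrt a - Num.sqrt b| <= Num.sqrt `|a - b|.
Proof.
wlog ab : a b / b <= a.
  move=> W; have [/W//|/ltW/W] := leP b a.
  by rewrite distrC [`|b - a|]distrC.
have sab : Num.sqrt b <= Num.sqrt a by exact: ler_wsqrtr.
rewrite !ger0_norm ?subr_ge0//.
have [b0|/ltW b0] := leP 0 b; last first.
  rewrite (ler0_sqrtr b0) subr0 ler_sqrt ?subr_ge0// lerBrDr gerDl//.
rewrite lerBlDr -ler_sqr ?nnegrE ?addr_ge0 ?sqrtr_ge0//.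
rewrite sqrrD !sqr_sqrtr ?subr_ge0//; last exact: le_trans ab.
have : 0 <= Num.sqrt (a - b) * Num.sqrt b by rewrite mulr_ge0 ?sqrtr_ge0.
lra.
Qed.

End NullSets.

(** * Balanced initializations form a null set *)

Section UnbalancedInitialization.
Variable R : realType.

Lemma linear_form_dist n (c x x' : 'rV[R]_n) (j0 : 'I_n) (delta : R) :
  0 <= delta -> (forall j, `|c 0 j| <= 1) -> c 0 j0 = 0 ->
  (forall j, j != j0 -> `|x 0 j - x' 0 j| <= delta) ->
  `|dot c x - dot c x'| <= n%:R * delta.
Proof.
move=> d0 c1 cj0 H; rewrite /dot -sumrB.
apply: (le_trans (ler_norm_sum _ _ _)).
rewrite mulr_natl -[n in leRHS]card_ord -sumr_const; apply: ler_sum => j _.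
rewrite -mulrBr normrM; have [->|jj0] := eqVneq j j0; first by rewrite cj0 normr0 mul0r.
by rewrite -[leRHS]mul1r ler_pM// H.
Qed.

Lemma linear_form_le n (c x : 'rV[R]_n) (m : R) :
  (forall j, `|c 0 j| <= 1) -> (forall j, `|x 0 j| <= m) -> `|dot c x| <= n%:R * m.
Proof.
move=> c1 H; rewrite /dot.
apply: (le_trans (ler_norm_sum _ _ _)).
rewrite mulr_natl -[n in leRHS]card_ord -sumr_const; apply: ler_sum => j _.
by rewrite normrM -[leRHS]mul1r ler_pM.
Qed.

(** One branch of [c0^2 + c1^2 = c2^2 + c3^2] solved for [c0]: only [c0] involves the coordinate
    [j0], so the branch is a graph over the other coordinates. *)
Lemma content_zero_quadric n (j0 : 'I_n) (m : R) (b : bool) (c0 c1 c2 c3 : 'rV[R]_n) :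
  0 < m ->
  (forall j, `|c0 0 j| <= 1) -> (forall j, `|c1 0 j| <= 1) ->
  (forall j, `|c2 0 j| <= 1) -> (forall j, `|c3 0 j| <= 1) ->
  c0 0 j0 = 1 -> c1 0 j0 = 0 -> c2 0 j0 = 0 -> c3 0 j0 = 0 ->
  content_zero _ _ [set x : 'rV[R]_n | (forall j, `|x 0 j| <= m) /\
    dot c0 x = (-1) ^+ b * Num.sqrt (dot c2 x ^+ 2 + dot c3 x ^+ 2 - dot c1 x ^+ 2)].
Proof.
move=> m0 b0 b1 b2 b3 e0 e1 e2 e3.
apply: (content_zero_graph _ _ j0 m) => // [x []//|kappa k0].
have n0 : 0 < n%:R :> R by rewrite ltr0n (leq_ltn_trans _ (ltn_ord j0)).
(* The first bound controls the rest of the linear form [c0]. The second controls the radicand, each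
   of its three squares varying by at most [n * delta * (2 * n * m)]; the square root turns
   [(kappa / 2)^2] into [kappa / 2]. *)
pose delta := Num.min (kappa / 2 / n%:R) ((kappa / 2) ^+ 2 / (6 * n%:R ^+ 2 * m)).
have q0 : 0 < 6 * n%:R ^+ 2 * m by rewrite !mulr_gt0.
have d0 : 0 < delta.
  by rewrite lt_min !divr_gt0// exprn_gt0// divr_gt0.
have d1 : n%:R * delta <= kappa / 2 by rewrite mulrC -ler_pdivlMr// ge_min lexx.
have d2 : 6 * n%:R ^+ 2 * m * delta <= (kappa / 2) ^+ 2.
  by rewrite mulrC -ler_pdivlMr// ge_min lexx orbT.
exists delta => // x x' [xm xE] [xm' xE'] H.
pose c0' := c0 - delta_mx 0 j0.
have E y : dot c0 y = y 0 j0 + dot c0' y.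
  rewrite /dot (bigD1 j0)//= [in RHS](bigD1 j0)//= e0 mul1r !mxE !eqxx e0 subrr mul0r add0r.
  congr (_ + _); apply: eq_bigr => j jj0; rewrite !mxE (negbTE jj0) andbF subr0//.
have c0'j0 : c0' 0 j0 = 0 by rewrite !mxE !eqxx e0 subrr.
have c0'b j : `|c0' 0 j| <= 1.
  by have [->|jj0] := eqVneq j j0; rewrite ?c0'j0 ?normr0// !mxE (negbTE jj0) andbF subr0.
pose q y := dot c2 y ^+ 2 + dot c3 y ^+ 2 - dot c1 y ^+ 2.
have -> : x 0 j0 - x' 0 j0 = (-1) ^+ b * (Num.sqrt (q x) - Num.sqrt (q x'))
    - (dot c0' x - dot c0' x').
  by have := E x; have := E x'; rewrite xE xE' -/(q x) -/(q x'); lra.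
apply: (le_trans (ler_normB _ _)).
have H0 := linear_form_dist _ _ _ _ _ _ (ltW d0) c0'b c0'j0 H.
have sq (c : 'rV[R]_n) : (forall j, `|c 0 j| <= 1) -> c 0 j0 = 0 ->
    `|dot c x ^+ 2 - dot c x' ^+ 2| <= n%:R * delta * (2 * n%:R * m).
  move=> cb cj; rewrite subr_sqr normrM ler_pM//.
    exact: (linear_form_dist _ _ _ _ _ _ (ltW d0) cb cj H).
  apply: (le_trans (ler_normD _ _)).
  have := linear_form_le _ _ _ _ cb xm; have := linear_form_le _ _ _ _ cb xm'; lra.
have Hq : `|q x - q x'| <= (kappa / 2) ^+ 2.
  apply: le_trans d2.
  have -> : q x - q x' = (dot c2 x ^+ 2 - dot c2 x' ^+ 2) + (dot c3 x ^+ 2 - dot c3 x' ^+ 2)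
     - (dot c1 x ^+ 2 - dot c1 x' ^+ 2) by rewrite /q; ring.
  apply: (le_trans (ler_normB _ _)); apply: (le_trans (lerD (ler_normD _ _) (lexx _))).
  have := sq _ b1 e1; have := sq _ b2 e2; have := sq _ b3 e3.
  have -> : 6 * n%:R ^+ 2 * m * delta = 3 * (n%:R * delta * (2 * n%:R * m)) by ring.
  lra.
have Hs : `|Num.sqrt (q x) - Num.sqrt (q x')| <= kappa / 2.
  apply: (le_trans (sqrt_dist _ _ _)); apply: (le_trans (ler_wsqrtr Hq)).
  by rewrite sqrtr_sqr ger0_norm// divr_ge0// ltW.
rewrite normrM normrX normrN1 expr1n mul1r; lra.
Qed.

(** The distinguished coordinate is entry 0 of the first layer, where every cosine is 1 and every
    sine is 0. The countable index runs over the frequency, the sign of the real part and the size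
    of a cube. *)
Lemma balanced_null D : (0 < D)%N -> leb_null [set u : 'rV[R]_(D + D) | exists d : 'I_D,
  dft_re (lsubmx u) d ^+ 2 + dft_im (lsubmx u) d ^+ 2 =
  dft_re (rsubmx u) d ^+ 2 + dft_im (rsubmx u) d ^+ 2].
Proof.
case: D => // D _.
pose cosv (d : 'I_D.+1) : 'rV[R]_D.+1 := \row_p cos (ang R _ d p).
pose sinv (d : 'I_D.+1) : 'rV[R]_D.+1 := \row_p sin (ang R _ d p).
pose j0 : 'I_(D.+1 + D.+1) := lshift D.+1 ord0.
have dotl (v : 'rV[R]_D.+1) (u : 'rV[R]_(D.+1 + D.+1)) :
    dot (row_mx v 0) u = dot v (lsubmx u).
  rewrite /dot big_split_ord/= [X in _ + X]big1 ?addr0.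
    by apply: eq_bigr => p _; rewrite row_mxEl mxE.
  by move=> p _; rewrite row_mxEr mxE mul0r.
have dotr (v : 'rV[R]_D.+1) (u : 'rV[R]_(D.+1 + D.+1)) :
    dot (row_mx 0 v) u = dot v (rsubmx u).
  rewrite /dot big_split_ord/= [X in X + _]big1 ?add0r.
    by apply: eq_bigr => p _; rewrite row_mxEr mxE.
  by move=> p _; rewrite row_mxEl mxE mul0r.
have bl (v : 'rV[R]_D.+1) j : (forall i, `|v 0 i| <= 1) ->
    `|(row_mx v (0 : 'rV[R]_D.+1)) 0 j| <= 1.
  by move=> v1; rewrite mxE; case: (fintype.split j) => i//; rewrite mxE normr0.
have br (v : 'rV[R]_D.+1) j : (forall i, `|v 0 i| <= 1) ->
    `|(row_mx (0 : 'rV[R]_D.+1) v) 0 j| <= 1.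
  by move=> v1; rewrite mxE; case: (fintype.split j) => i//; rewrite mxE normr0.
have cos1 d i : `|cosv d 0 i| <= 1.
  by rewrite mxE ler_norml cos_geN1 cos_le1.
have sin1 d i : `|sinv d 0 i| <= 1.
  by rewrite mxE ler_norml sin_geN1 sin_le1.
pose A (i : 'I_D.+1 * bool * nat) : set 'rV[R]_(D.+1 + D.+1) := [set x : 'rV[R]_(D.+1 + D.+1) |
  (forall j, `|x 0 j| <= i.2.+1%:R) /\
  dot (row_mx (cosv i.1.1) 0) x = (-1) ^+ i.1.2 * Num.sqrt (dot (row_mx 0 (cosv i.1.1)) x ^+ 2 +
    dot (row_mx 0 (sinv i.1.1)) x ^+ 2 - dot (row_mx (sinv i.1.1) 0) x ^+ 2)].
have Anull i : content_zero _ _ (A i).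
  apply: (content_zero_quadric _ j0); rewrite ?ltr0n//.
  - by move=> j; apply: bl => ?.
  - by move=> j; apply: bl => ?.
  - by move=> j; apply: br => ?.
  - by move=> j; apply: br => ?.
  - by rewrite row_mxEl mxE /ang mul0r mulr0 mul0r cos0.
  - by rewrite row_mxEl mxE /ang mul0r mulr0 mul0r sin0.
  - by rewrite row_mxEl mxE.
  - by rewrite row_mxEl mxE.
move=> eps e0.
have [lo [hi [H1 [H2 H3]]]] := leb_null_countable_content_zero R (D + D.+1)%N _ A Anull eps e0.
exists lo, hi; split => //; split => // u [d Hd]; apply: H2.
have [k Hk] : exists k : nat, forall j, `|u 0 j| <= k.+1%:R.
  exists (\max_(j : 'I_(D.+1 + D.+1)) Num.truncn (`|u 0 j|)%R) => j.
  apply: (@le_trans _ _ (Num.truncn `|u 0 j|).+1%:R); first by rewrite ltW// truncnS_gt.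
  by rewrite ler_nat ltnS (leq_bigmax j).
exists (d, dot (row_mx (cosv d) 0) u < 0, k); split => //=.
rewrite !dotl !dotr.
have s0 := sqrtD_neq0 R _ d.
have reE (v : 'rV[R]_D.+1) : dft_re v d = (Num.sqrt D.+1%:R)^-1 * dot (cosv d) v.
  by rewrite dft_reE; congr (_ * _); apply: eq_bigr => p _; rewrite mxE mulrC.
have imE (v : 'rV[R]_D.+1) : dft_im v d = - ((Num.sqrt D.+1%:R)^-1 * dot (sinv d) v).
  by rewrite dft_imE; congr (- (_ * _)); apply: eq_bigr => p _; rewrite mxE mulrC.
move: Hd; rewrite !reE !imE !sqrrN !exprMn -!mulrDr => /mulfI Hd.
have {}Hd : dot (cosv d) (lsubmx u) ^+ 2 = dot (cosv d) (rsubmx u) ^+ 2 +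
    dot (sinv d) (rsubmx u) ^+ 2 - dot (sinv d) (lsubmx u) ^+ 2.
  by rewrite -Hd ?addrK// expf_neq0// invr_eq0.
rewrite -Hd sqrtr_sqr; have [h|h] := ltP.
  by rewrite ltr0_norm// expr1 mulN1r opprK.
by rewrite ger0_norm// expr0 mul1r.
Qed.

End UnbalancedInitialization.

(** * Inner product and directional derivatives *)

Section Calculus.
Variables (R : realType).

Lemma dotC n (x w : 'rV[R]_n) : dot x w = dot w x.
Proof. by apply: eq_bigr => i _; rewrite mulrC. Qed.

Lemma dotDr n (x v w : 'rV[R]_n) (a : R) : dot x (v + a *: w) = dot x v + a * dot x w.
Proof. by rewrite /dot mulr_sumr -big_split; apply: eq_bigr => i _; rewrite !mxE/=; ring. Qed.

Lemma dotDl n (x v w : 'rV[R]_n) (a : R) : dot (v + a *: w) x = dot v x + a * dot w x.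
Proof. by rewrite dotC dotDr !(dotC _ x). Qed.

Lemma dotZr n (x w : 'rV[R]_n) (a : R) : dot x (a *: w) = a * dot x w.
Proof. by rewrite /dot mulr_sumr; apply: eq_bigr => i _; rewrite !mxE/=; ring. Qed.

Lemma dotZl n (x w : 'rV[R]_n) (a : R) : dot (a *: w) x = a * dot w x.
Proof. by rewrite dotC dotZr dotC. Qed.

Lemma dot_ge0 n (x : 'rV[R]_n) : 0 <= dot x x.
Proof. by apply: sumr_ge0 => i _; rewrite -expr2 sqr_ge0. Qed.

Lemma norm2_ge0 n (x : 'rV[R]_n) : 0 <= norm2 x. Proof. exact: sqrtr_ge0. Qed.

Lemma norm2_sqr n (x : 'rV[R]_n) : norm2 x ^+ 2 = dot x x.
Proof. by rewrite sqr_sqrtr// dot_ge0. Qed.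

Lemma norm2Z n (x : 'rV[R]_n) (a : R) : 0 <= a -> norm2 (a *: x) = a * norm2 x.
Proof. by move=> a0; rewrite /norm2 dotZl dotZr mulrA -expr2 sqrtrM ?sqr_ge0// sqrtr_sqr ger0_norm. Qed.

Lemma norm2N n (x : 'rV[R]_n) : norm2 (- x) = norm2 x.
Proof. by rewrite -scaleN1r /norm2 dotZl dotZr mulrA mulrNN mulr1 mul1r. Qed.

Lemma dot_eq0 n (x : 'rV[R]_n) : dot x x = 0 -> x = 0.
Proof.
move=> /eqP; rewrite psumr_eq0 => [/allP H|i _]; last by rewrite -expr2 sqr_ge0.
apply/rowP => i; rewrite mxE; apply/eqP.
by have := H i (mem_index_enum _); rewrite /= mulf_eq0 orbb.
Qed.

Lemma cauchy_schwarz n (x w : 'rV[R]_n) : dot x w <= norm2 x * norm2 w.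
Proof.
have [a0|a0] := eqVneq (norm2 x) 0.
  have -> : x = 0 by apply: dot_eq0; rewrite -norm2_sqr a0 expr0n.
  by rewrite /dot big1 ?mulr_ge0 ?norm2_ge0// => i _; rewrite mxE mul0r.
have [b0|b0] := eqVneq (norm2 w) 0.
  have -> : w = 0 by apply: dot_eq0; rewrite -norm2_sqr b0 expr0n.
  by rewrite /dot big1 ?mulr_ge0 ?norm2_ge0// => i _; rewrite mxE mulr0.
have ab0 : 0 < norm2 x * norm2 w.
  by rewrite lt_neqAle eq_sym mulf_eq0 (negbTE a0) (negbTE b0) mulr_ge0 ?norm2_ge0.
have := dot_ge0 _ (norm2 w *: x + (- norm2 x) *: w).
rewrite dotDr !dotDl !dotZl !dotZr -!norm2_sqr (dotC _ w x).
move: (dot x w) => c H; rewrite -(ler_pM2l ab0).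
lra.
Qed.

Lemma cauchy_schwarz_norm n (x w : 'rV[R]_n) : `|dot x w| <= norm2 x * norm2 w.
Proof.
rewrite ler_norml cauchy_schwarz andbT lerNl -mulN1r -dotZl.
by rewrite -[norm2 x]norm2N -[- x]scaleN1r; exact: cauchy_schwarz.
Qed.

(** Quadratic exponents are the relevant ones: along a line in parameter space the network output is
    a polynomial of degree two. *)
Lemma is_derive_expsum N (c0 c1 c2 : 'I_N -> R) (s0 : R) :
  is_derive s0 1 (fun s : R => \sum_(n < N) expR (- (c0 n + c1 n * s + c2 n * s ^+ 2)))
    (\sum_(n < N) - (c1 n + 2 * c2 n * s0) * expR (- (c0 n + c1 n * s0 + c2 n * s0 ^+ 2))).
Proof.
have -> : (fun s : R => \sum_(n < N) expR (- (c0 n + c1 n * s + c2 n * s ^+ 2))) =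
   \sum_(n < N) (fun s : R => expR (- (c0 n + c1 n * s + c2 n * s ^+ 2))).
  by apply/funext => s; rewrite fct_sumE.
apply: is_derive_sum => n.
apply: is_derive_eq.
rewrite /GRing.scale/=; ring.
Qed.

Lemma is_derive_wexpsum N (c0 c1 c2 : 'I_N -> R) :
  is_derive (0 : R) 1 (fun s : R => \sum_(n < N) - (c1 n + 2 * c2 n * s) * expR (- (c0 n + c1 n * s + c2 n * s ^+ 2)))
    (\sum_(n < N) (c1 n ^+ 2 - 2 * c2 n) * expR (- c0 n)).
Proof.
have -> : (fun s : R => \sum_(n < N) - (c1 n + 2 * c2 n * s) * expR (- (c0 n + c1 n * s + c2 n * s ^+ 2))) =
   \sum_(n < N) (fun s : R => - (c1 n + 2 * c2 n * s) * expR (- (c0 n + c1 n * s + c2 n * s ^+ 2))).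
  by apply/funext => s; rewrite fct_sumE.
apply: is_derive_sum => n.
apply: is_derive_eq.
rewrite /GRing.scale/= !mulr0 !expr0n !mulr0 !addr0; ring.
Qed.

Lemma derive_line n (f : 'rV[R]_n -> R) (u v : 'rV[R]_n) (g : R -> R) (dg : R) :
  (forall s, f (u + s *: v) = g s) -> is_derive (0 : R) 1 g dg -> 'D_v f u = dg.
Proof.
move=> fg [_ <-]; rewrite /derive.
suff -> : (fun h : R => h^-1 *: ((f \o shift u) (h *: v) - f u)) =
  (fun h : R => h^-1 *: ((g \o shift 0) (h *: (1 : R)) - g 0)) by [].
have fu : f u = g 0 by rewrite -fg scale0r addr0.
apply/funext => h /=; rewrite [h *: v + u]addrC fg fu.
by rewrite /GRing.scale/= mulr1 addr0.
Qed.

Lemma derive_right_le (phi : R -> R) (dphi C r : R) : is_derive (0 : R) 1 phi dphi -> 0 < r ->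
  (forall s, 0 < s -> s <= r -> phi s - phi 0 <= C * s) -> dphi <= C.
Proof.
move=> [dv <-] r0 H; rewrite leNgt; apply/negP => lt.
have cv : (fun h : R => h^-1 *: ((phi \o shift 0) (h *: 1) - phi 0)) @ 0^' --> 'D_1 phi 0 by exact: dv.
have [e /= e0 He] : nbhs_ball (0 : R) (fun h : R => h != 0 ->
    C < h^-1 *: ((phi \o shift 0) (h *: (1 : R)) - phi 0)).
  by apply/nbhs_ballP; exact: (cvgr_gt _ cv C lt).
have m0 : 0 < Num.min (e / 2) r by rewrite lt_min r0 divr_gt0.
have := He (Num.min (e / 2) r).
rewrite /ball/= sub0r normrN gtr0_norm//.
have -> : Num.min (e / 2) r < e by rewrite gt_min ltr_pdivrMr// ltr_pMr// ltr1n.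
move=> /(_ isT (lt0r_neq0 m0)).
rewrite /GRing.scale/= mulr1 addr0 mulrC ltr_pdivlMr//.
by apply/negP; rewrite -leNgt; apply: H; rewrite // ge_min lexx orbT.
Qed.

End Calculus.

(** * Gradient and curvature of the loss *)

Section GradientOfLoss.
Variables (R : realType) (D N : nat) (X : 'I_N -> 'rV[R]_D) (y : 'I_N -> R).
Implicit Types (x w z : 'rV[R]_D) (u v : 'rV[R]_(D + D)) (d : 'I_D).

Definition negloss_grad w : 'rV[R]_D :=
  \sum_(n < N) (y n * expR (- (y n * dot (X n) w))) *: X n.

Lemma dot_negloss_grad w (v : 'rV[R]_D) :
  dot (negloss_grad w) v = \sum_(n < N) y n * dot (X n) v * expR (- (y n * dot (X n) w)).
Proof.
rewrite {1}/dot.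
under eq_bigr do rewrite /negloss_grad summxE mulr_suml.
rewrite exchange_big/=; apply: eq_bigr => n _.
by rewrite -/(dot (_ *: X n) v) dotZl; ring.
Qed.

Lemma grad_Lw w : grad (Lw X y) w = - negloss_grad w.
Proof.
apply/rowP => i; rewrite !mxE.
rewrite (derive_line _ _ _ _ (delta_mx 0 i) _ _ _
   (is_derive_expsum _ _ (fun n => y n * dot (X n) w) (fun n => y n * X n 0 i) (fun=> 0) 0)).
  rewrite /negloss_grad summxE -sumrN; apply: eq_bigr => n _.
  by rewrite !mxE !mulr0 mul0r !addr0; ring.
move=> s; rewrite /Lw; apply: eq_bigr => n _; rewrite dotDr; congr (expR (- _)).
have -> : dot (X n) (delta_mx 0 i) = X n 0 i.
  rewrite /dot (bigD1 i)//= big1 ?addr0 ?mxE ?eqxx ?mulr1// => j ji.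
  by rewrite mxE (negbTE ji) andbF mulr0.
ring.
Qed.

(** The gradient of [fconv _ x] at [u], as the linear coefficient in [fconv_line] confirms. *)
Definition conv_diff u x : 'rV[R]_(D + D) :=
  row_mx (cconv x (rsubmx u)) (cconv x (lsubmx u)).

Lemma dot_row_mx (a b : 'rV[R]_D) v :
  dot (row_mx a b) v = dot a (lsubmx v) + dot b (rsubmx v).
Proof.
rewrite /dot big_split_ord/=; congr (_ + _); apply: eq_bigr => i _.
  by rewrite row_mxEl mxE.
by rewrite row_mxEr mxE.
Qed.

Lemma cconvDr x (a b : 'rV[R]_D) (s : R) : cconv x (a + s *: b) = cconv x a + s *: cconv x b.
Proof.
apply/rowP => i; rewrite !mxE mulrCA -mulrDr; congr (_ * _); rewrite mulr_sumr -big_split/=.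
by apply: eq_bigr => k _; rewrite !mxE; ring.
Qed.

Lemma dot_cconvC x (a b : 'rV[R]_D) : dot (cconv x a) b = dot (cconv x b) a.
Proof.
by have := fconv_sym R D (row_mx a b) x; rewrite /fconv row_mxKl row_mxKr.
Qed.

Lemma lsubmx_line u v (s : R) : lsubmx (u + s *: v) = lsubmx u + s *: lsubmx v.
Proof. by rewrite linearD linearZ. Qed.

Lemma rsubmx_line u v (s : R) : rsubmx (u + s *: v) = rsubmx u + s *: rsubmx v.
Proof. by rewrite linearD linearZ. Qed.

Lemma fconv_line u v x (s : R) : fconv (u + s *: v) x =
  fconv u x + dot (conv_diff u x) v * s + fconv v x * s ^+ 2.
Proof.
rewrite /fconv lsubmx_line rsubmx_line.
rewrite cconvDr dotDr !dotDl /conv_diff dot_row_mx.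
rewrite (dot_cconvC x (lsubmx v) (rsubmx u)); ring.
Qed.

Lemma conv_diff_line u v x (s : R) : dot (conv_diff (u + s *: v) x) v =
  dot (conv_diff u x) v + 2 * fconv v x * s.
Proof.
rewrite /conv_diff lsubmx_line rsubmx_line.
rewrite !dot_row_mx !cconvDr !dotDl /fconv (dot_cconvC x (rsubmx v)); ring.
Qed.

(** Polarization makes the linearity in [x] visible, so that [conv_diff] can be summed over the
    samples. *)
Lemma dot_conv_diff_PconvE u v x : dot (conv_diff u x) v =
  dot x (Pconv (u + v)) - dot x (Pconv u) - dot x (Pconv v).
Proof. by rewrite -!PconvP -[in u + v](scale1r v) fconv_line; ring. Qed.

Lemma dot_conv_diff_negloss u v w : dot (conv_diff u (negloss_grad w)) v =
  \sum_(n < N) y n * dot (conv_diff u (X n)) v * expR (- (y n * dot (X n) w)).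
Proof.
rewrite dot_conv_diff_PconvE !dot_negloss_grad -!sumrB; apply: eq_bigr => n _.
by rewrite dot_conv_diff_PconvE; ring.
Qed.

Lemma LconvE u : Lconv X y u = \sum_(n < N) expR (- (y n * fconv u (X n))).
Proof. by apply: eq_bigr => n _; rewrite PconvP. Qed.

Lemma Lconv_line u v (s : R) : Lconv X y (u + s *: v) =
  \sum_(n < N) expR (- (y n * fconv u (X n) + y n * dot (conv_diff u (X n)) v * s
    + y n * fconv v (X n) * s ^+ 2)).
Proof.
rewrite LconvE; apply: eq_bigr => n _; congr (expR (- _)).
by rewrite fconv_line; ring.
Qed.

Lemma grad_Lconv u : grad (Lconv X y) u = - conv_diff u (negloss_grad (Pconv u)).
Proof.
apply/rowP => i; rewrite [LHS]mxE [RHS]mxE.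
rewrite (derive_line _ _ _ _ (delta_mx 0 i) _ _ (Lconv_line u _) (is_derive_expsum _ _ _ _ _ 0)).
have -> : conv_diff u (negloss_grad (Pconv u)) 0 i =
    dot (conv_diff u (negloss_grad (Pconv u))) (delta_mx 0 i).
  rewrite /dot (bigD1 i)//= big1 ?addr0 => [|j ji].
    by rewrite [delta_mx _ _ _ _]mxE !eqxx mulr1.
  by rewrite [delta_mx _ _ _ _]mxE (negbTE ji) andbF mulr0.
rewrite dot_conv_diff_negloss -sumrN; apply: eq_bigr => n _.
rewrite -PconvP expr0n/= !mulr0 !addr0; ring.
Qed.

(** The left-hand side is the second derivative of the loss at [u] along [v], the derivative at 0 of
    the gradient paired with [v]; the Lipschitz bound and Cauchy-Schwarz control its difference
    quotients. *)
Lemma second_derivative_le u v (r beta : R) : 0 < r ->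
  grad_lipschitz_on (Lconv X y) u r beta ->
  \sum_(n < N) ((y n * dot (conv_diff u (X n)) v) ^+ 2 - 2 * (y n * fconv v (X n)))
     * expR (- (y n * fconv u (X n))) <= beta * dot v v.
Proof.
move=> r0 Lip.
have der := is_derive_wexpsum R N (fun n => y n * fconv u (X n))
  (fun n => y n * dot (conv_diff u (X n)) v) (fun n => y n * fconv v (X n)).
set phi := (fun s : R => _) in der.
have phiE s : phi s = dot (grad (Lconv X y) (u + s *: v)) v.
  rewrite grad_Lconv -scaleN1r dotZl dot_conv_diff_negloss mulr_sumr /phi.
  apply: eq_bigr => n _; rewrite conv_diff_line -PconvP fconv_line.
  have -> : y n * (fconv u (X n) + dot (conv_diff u (X n)) v * s + fconv v (X n) * s ^+ 2) =
    y n * fconv u (X n) + y n * dot (conv_diff u (X n)) v * s + y n * fconv v (X n) * s ^+ 2 by ring.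
  ring.
(* Steps up to [r / (norm2 v + 1)] stay in the ball of radius [r], also for [v = 0]. *)
have nv : 0 < norm2 v + 1 by rewrite ltr_wpDl// norm2_ge0.
apply: (derive_right_le _ phi _ _ (r / (norm2 v + 1)) der); first by rewrite divr_gt0.
move=> s s0; rewrite ler_pdivlMr// => sr.
have sub : phi s - phi 0 = dot (grad (Lconv X y) (u + s *: v) - grad (Lconv X y) u) v.
  by rewrite !phiE scale0r addr0 -(scaleN1r (grad _ u)) dotDl mulN1r.
rewrite sub; apply: (le_trans (cauchy_schwarz _ _ _ _)).
have suv : norm2 (u + s *: v - u) = s * norm2 v by rewrite addrAC subrr add0r norm2Z// ltW.
have := Lip (u + s *: v) u; rewrite suv subrr.
have -> : norm2 (0 : 'rV[R]_(D + D)) = 0.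
  by rewrite /norm2 /dot big1 ?sqrtr0// => i _; rewrite mxE mul0r.
move=> /(_ _ (ltW r0)) H.
have {}H : norm2 (grad (Lconv X y) (u + s *: v) - grad (Lconv X y) u) <= beta * (s * norm2 v).
  by apply: H; apply: le_trans sr; rewrite ler_wpM2l ?lerDl// ltW.
apply: (le_trans (ler_wpM2r (norm2_ge0 _ _ v) H)).
by rewrite -norm2_sqr le_eqVlt; apply/orP; left; apply/eqP; ring.
Qed.

(** Dropping the nonnegative squares from the second derivative leaves the curvature of the network
    itself, weighted by the samples. *)
Lemma lipschitz_ge_fconv u v (r beta : R) : 0 < r ->
  grad_lipschitz_on (Lconv X y) u r beta ->
  - 2 * fconv v (negloss_grad (Pconv u)) <= beta * dot v v.
Proof.
move=> r0 /(second_derivative_le _ v _ _ r0); apply: le_trans.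
rewrite PconvP dot_negloss_grad mulr_sumr; apply: ler_sum => n _.
rewrite -!PconvP; have := sqr_ge0 (y n * dot (conv_diff u (X n)) v).
have := expR_ge0 (- (y n * fconv u (X n))) => e0 q0.
have := mulr_ge0 q0 e0; lra.
Qed.

(* With [H := cconv z], the directions [(e, - H e / |z^[d]|)] for [e] the cosine
   and the sine of frequency [d] together behave like an eigenvector of
   eigenvalue [|z^[d]|]. *)
Lemma lipschitz_ge_dft_abs u (r beta : R) d : 0 < r ->
  grad_lipschitz_on (Lconv X y) u r beta ->
  dft_abs (negloss_grad (Pconv u)) d <= beta.
Proof.
move=> r0 Lip; set z := negloss_grad _.
have D0 : 0 < D%:R :> R by rewrite ltr0n (ord_pos d).
pose cosv : 'rV[R]_D := \row_p cos (ang R D d p).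
pose sinv : 'rV[R]_D := \row_p sin (ang R D d p).
have Hcos : cconv z cosv =
    \row_p (dft_re z d * cos (ang R D d p) - dft_im z d * sin (ang R D d p)).
  apply/rowP => k; rewrite !mxE.
  under eq_bigr do rewrite mxE.
  rewrite cos_sum_shift dft_reE dft_imE; ring.
have Hsin : cconv z sinv =
    \row_p - (dft_im z d * cos (ang R D d p) + dft_re z d * sin (ang R D d p)).
  apply/rowP => k; rewrite !mxE.
  under eq_bigr do rewrite mxE.
  rewrite sin_sum_shift dft_reE dft_imE; ring.
(* Only the sum of both squared norms is [D] for every frequency; at [d = 0], for instance, the sine
   vector vanishes. *)
have E1 : dot cosv cosv + dot sinv sinv = D%:R.
  rewrite /dot -big_split/= -[in RHS](card_ord D) -sumr_const; apply: eq_bigr => p _.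
  by rewrite !mxE -!expr2 cos2Dsin2.
have E2 : dot (cconv z cosv) (cconv z cosv) + dot (cconv z sinv) (cconv z sinv) =
    D%:R * dft_abs z d ^+ 2.
  have -> : D%:R * dft_abs z d ^+ 2 = \sum_(p < D) dft_abs z d ^+ 2.
    by rewrite sumr_const card_ord mulr_natl.
  rewrite Hcos Hsin /dot -big_split/=; apply: eq_bigr => p _; rewrite !mxE dft_abs_sqr -[RHS]mul1r.
  rewrite -(cos2Dsin2 (ang R D d p)); ring.
have test e (l : R) : 2 * l * dot (cconv z e) (cconv z e) <=
    beta * (dot e e + l ^+ 2 * dot (cconv z e) (cconv z e)).
  have := lipschitz_ge_fconv u (row_mx e ((- l) *: cconv z e)) r beta r0 Lip.
  rewrite -/z /fconv dot_row_mx row_mxKl row_mxKr dotZr dotZl.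
  rewrite dotZr; lra.
(* If the coefficient vanishes, [l = 0] already yields [beta >= 0]; otherwise [l = 1 / |z^[d]|]
   balances the two components of the test direction. *)
have [a0|a0] := eqVneq (dft_abs z d) 0.
  have := test cosv 0; have := test sinv 0; rewrite a0.
  move=> t1 t2.
  have : 0 <= beta * D%:R by rewrite -E1; lra.
  by rewrite pmulr_lge0.
have := test cosv (dft_abs z d)^-1; have := test sinv (dft_abs z d)^-1.
move=> t1 t2.
have t3 : 2 * (dft_abs z d)^-1 * (D%:R * dft_abs z d ^+ 2) <=
   beta * (D%:R + (dft_abs z d)^-1 ^+ 2 * (D%:R * dft_abs z d ^+ 2)).
  rewrite -E2 -E1; lra.
have l1 : 2 * (dft_abs z d)^-1 * (D%:R * dft_abs z d ^+ 2) = 2 * D%:R * dft_abs z d by field.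
have l2 : beta * (D%:R + (dft_abs z d)^-1 ^+ 2 * (D%:R * dft_abs z d ^+ 2)) = 2 * D%:R * beta by field.
by move: t3; rewrite l1 l2 ler_pM2l// mulr_gt0.
Qed.

(** The second derivative along [u] itself: [fconv] is homogeneous of degree two, so its gradient
    paired with [u] is twice its value. *)
Lemma lipschitz_ge_margins u (r beta : R) : 0 < r ->
  grad_lipschitz_on (Lconv X y) u r beta ->
  \sum_(n < N) (4 * (y n * dot (X n) (Pconv u)) ^+ 2 - 2 * (y n * dot (X n) (Pconv u)))
    * expR (- (y n * dot (X n) (Pconv u))) <= beta * dot u u.
Proof.
move=> r0 /(second_derivative_le _ u _ _ r0); apply: le_trans.
rewrite le_eqVlt; apply/orP; left; apply/eqP; apply: eq_bigr => n _; rewrite -PconvP; congr (_ * _).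
have -> : dot (conv_diff u (X n)) u = 2 * fconv u (X n).
  by rewrite /conv_diff dot_row_mx /fconv (dot_cconvC _ (rsubmx u)); ring.
ring.
Qed.

End GradientOfLoss.

(** * Limits of directions and of Fourier coefficients *)

Section Limits.
Variable R : realType.

Lemma cvg_dot n (x l : 'rV[R]_n) (v : nat -> 'rV[R]_n) :
  v @ \oo --> l -> (fun t => dot x (v t)) @ \oo --> dot x l.
Proof.
move=> vl; apply: cvg_big => [|i _]; first exact: add_continuous.
apply: cvgMl_tmp; apply: (@continuous_cvg _ _ _ _ _ v (fun M : 'rV[R]_n => M 0 i) l _ vl).
exact: coord_continuous.
Qed.

Lemma cvg_dot_self n (l : 'rV[R]_n) (v : nat -> 'rV[R]_n) :
  v @ \oo --> l -> (fun t => dot (v t) (v t)) @ \oo --> dot l l.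
Proof.
move=> vl; apply: cvg_big => [|i _]; first exact: add_continuous.
have vi : (fun t => v t 0 i) @ \oo --> l 0 i.
  apply: (@continuous_cvg _ _ _ _ _ v (fun M : 'rV[R]_n => M 0 i) l _ vl).
  exact: coord_continuous.
exact: (cvgM vi vi).
Qed.

Lemma cvg_dft_re D (l : 'rV[R]_D) (v : nat -> 'rV[R]_D) d :
  v @ \oo --> l -> (fun t => dft_re (v t) d) @ \oo --> dft_re l d.
Proof.
move=> vl; pose c : 'rV[R]_D := \row_p cos (ang R D d p).
have E x : dft_re x d = (Num.sqrt D%:R)^-1 * dot c x.
  by rewrite dft_reE; congr (_ * _); apply: eq_bigr => p _; rewrite mxE mulrC.
under eq_fun do rewrite E; rewrite E.
by apply: cvgMl_tmp; exact: cvg_dot.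
Qed.

Lemma cvg_dft_im D (l : 'rV[R]_D) (v : nat -> 'rV[R]_D) d :
  v @ \oo --> l -> (fun t => dft_im (v t) d) @ \oo --> dft_im l d.
Proof.
move=> vl; pose c : 'rV[R]_D := \row_p sin (ang R D d p).
have E x : dft_im x d = - (Num.sqrt D%:R)^-1 * dot c x.
  by rewrite dft_imE mulNr; congr (- (_ * _)); apply: eq_bigr => p _; rewrite mxE mulrC.
under eq_fun do rewrite E; rewrite E.
by apply: cvgMl_tmp; exact: cvg_dot.
Qed.

Lemma cvg_dft_abs D (l : 'rV[R]_D) (v : nat -> 'rV[R]_D) d :
  v @ \oo --> l -> (fun t => dft_abs (v t) d) @ \oo --> dft_abs l d.
Proof.
move=> vl; apply: (@continuous_cvg _ _ _ _ _ (fun t => dft_re (v t) d ^+ 2 + dft_im (v t) d ^+ 2)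
  Num.sqrt); first exact: sqrt_continuous.
have r := cvg_dft_re _ _ _ d vl; have i := cvg_dft_im _ _ _ d vl.
by apply: cvgD; [exact: (cvgM r r)|exact: (cvgM i i)].
Qed.

Lemma cvg_ge_near (f : nat -> R) (l a : R) :
  f @ \oo --> l -> (\forall t \near \oo, a <= f t) -> a <= l.
Proof.
move=> fl H; rewrite -(cvg_lim (@Rhausdorff R) fl).
by apply: limr_ge => //; apply/cvg_ex; exists l.
Qed.

Lemma cvg_le_near (f : nat -> R) (l a : R) :
  f @ \oo --> l -> (\forall t \near \oo, f t <= a) -> l <= a.
Proof.
move=> fl H; rewrite -lerN2; apply: (cvg_ge_near (fun t => - f t)); first exact: cvgN.
by apply: filterS H => t; rewrite lerN2.
Qed.

Lemma norm2_dir n (x : 'rV[R]_n) : x = norm2 x *: dir x.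
Proof.
rewrite /dir scalerA; have [a0|a0] := eqVneq (norm2 x) 0; last by rewrite divff// scale1r.
by rewrite a0 mul0r scale0r; apply: dot_eq0; rewrite -norm2_sqr a0 expr0n.
Qed.

Lemma dot_dir n (x : 'rV[R]_n) : norm2 x != 0 -> dot (dir x) (dir x) = 1.
Proof.
move=> x0; rewrite /dir dotZl dotZr -norm2_sqr; field; exact: x0.
Qed.

Lemma dft_abs_le_norm2 D (x : 'rV[R]_D) d : dft_abs x d <= norm2 x.
Proof.
rewrite -ler_sqr ?nnegrE ?dft_abs_ge0 ?norm2_ge0// norm2_sqr parseval (bigD1 d)//=.
rewrite dft_abs_sqr -!expr2 lerDl sumr_ge0// => e _.
by rewrite addr_ge0// -expr2 sqr_ge0.
Qed.

End Limits.

(** * Gradient descent trajectories *)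

Section GradientDescent.
Variables (R : realType) (D N : nat) (X : 'I_N -> 'rV[R]_D) (y : 'I_N -> R).
Variables (u : nat -> 'rV[R]_(D + D)) (eta : nat -> R).
Hypothesis N_gt0 : (0 < N)%N.
Hypothesis unbalanced : forall d,
  dft_re (lsubmx (u 0%N)) d ^+ 2 + dft_im (lsubmx (u 0%N)) d ^+ 2 <>
  dft_re (rsubmx (u 0%N)) d ^+ 2 + dft_im (rsubmx (u 0%N)) d ^+ 2.
Hypothesis step : forall t, 0 < eta t /\
  exists r beta, 0 < r /\ grad_lipschitz_on (Lconv X y) (u t) r beta /\ eta t * beta < 1.
Hypothesis descent : forall t, u t.+1 = u t - eta t *: grad (Lconv X y) (u t).

Let w t := Pconv (u t).
Let z t := negloss_grad R D N X y (w t).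
Let h t := eta t * norm2 (z t).
Let cr d t := eta t * dft_re (z t) d.
Let ci d t := eta t * dft_im (z t) d.
Let Wr d t := dft_re (w t) d.
Let Wi d t := dft_im (w t) d.

Definition energy d t : R :=
  (dft_re (lsubmx (u t)) d ^+ 2 + dft_im (lsubmx (u t)) d ^+ 2 +
   (dft_re (rsubmx (u t)) d ^+ 2 + dft_im (rsubmx (u t)) d ^+ 2)) / 2.

Lemma eta_gt0 t : 0 < eta t. Proof. by have [] := step t. Qed.

Lemma lsubmx_step t : lsubmx (u t.+1) = lsubmx (u t) + eta t *: cconv (z t) (rsubmx (u t)).
Proof.
by rewrite descent grad_Lconv scalerN opprK lsubmx_line /conv_diff row_mxKl.
Qed.

Lemma rsubmx_step t : rsubmx (u t.+1) = rsubmx (u t) + eta t *: cconv (z t) (lsubmx (u t)).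
Proof.
by rewrite descent grad_Lconv scalerN opprK rsubmx_line /conv_diff row_mxKr.
Qed.

Lemma energy_ge0 d t : 0 <= energy d t.
Proof. by rewrite divr_ge0// !addr_ge0// sqr_ge0. Qed.

Lemma energy_rec d t : energy d t.+1 = (1 + (cr d t ^+ 2 + ci d t ^+ 2)) * energy d t
  + 2 * (cr d t * Wr d t + ci d t * Wi d t).
Proof.
rewrite /energy /cr /ci /Wr /Wi /w lsubmx_step rsubmx_step dft_re_Pconv dft_im_Pconv.
by rewrite !dft_reD !dft_imD !dft_re_cconv !dft_im_cconv; field.
Qed.

Lemma Wr_rec d t : Wr d t.+1 = Wr d t + 2 * cr d t * energy d t
  + ((cr d t ^+ 2 - ci d t ^+ 2) * Wr d t + 2 * cr d t * ci d t * Wi d t).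
Proof.
rewrite /energy /cr /ci /Wr /Wi /w !dft_re_Pconv !dft_im_Pconv lsubmx_step rsubmx_step.
by rewrite !dft_reD !dft_imD !dft_re_cconv !dft_im_cconv; field.
Qed.

Lemma Wi_rec d t : Wi d t.+1 = Wi d t + 2 * ci d t * energy d t
  + (2 * cr d t * ci d t * Wr d t - (cr d t ^+ 2 - ci d t ^+ 2) * Wi d t).
Proof.
rewrite /energy /cr /ci /Wr /Wi /w !dft_re_Pconv !dft_im_Pconv lsubmx_step rsubmx_step.
by rewrite !dft_reD !dft_imD !dft_re_cconv !dft_im_cconv; field.
Qed.

Lemma energy_gap d t : energy d t ^+ 2 - (Wr d t ^+ 2 + Wi d t ^+ 2) =
  ((dft_re (lsubmx (u t)) d ^+ 2 + dft_im (lsubmx (u t)) d ^+ 2 -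
   (dft_re (rsubmx (u t)) d ^+ 2 + dft_im (rsubmx (u t)) d ^+ 2)) / 2) ^+ 2.
Proof. by rewrite /energy /Wr /Wi /w dft_re_Pconv dft_im_Pconv; field. Qed.

Lemma W_le_energy d t : Wr d t ^+ 2 + Wi d t ^+ 2 <= energy d t ^+ 2.
Proof. by rewrite -subr_ge0 energy_gap sqr_ge0. Qed.

Lemma W_lt_energy0 d : Wr d 0%N ^+ 2 + Wi d 0%N ^+ 2 < energy d 0%N ^+ 2.
Proof.
rewrite -subr_gt0 energy_gap exprn_even_gt0//= mulf_neq0 ?invr_neq0//.
by rewrite subr_eq0; apply/eqP; exact: unbalanced.
Qed.

Lemma dft_abs_w_le_energy d t : dft_abs (w t) d <= energy d t.
Proof.
rewrite -ler_sqr ?nnegrE ?dft_abs_ge0 ?energy_ge0// dft_abs_sqr; exact: W_le_energy.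
Qed.

Lemma eta_dft_abs_lt1 d t : eta t * dft_abs (z t) d < 1.
Proof.
have [e0 [r [beta [r0 [Lip eb]]]]] := step t.
apply: le_lt_trans eb; rewrite ler_wpM2l ?(ltW e0)//.
exact: lipschitz_ge_dft_abs Lip.
Qed.

Lemma c_sqr d t : cr d t ^+ 2 + ci d t ^+ 2 = (eta t * dft_abs (z t) d) ^+ 2.
Proof. by rewrite [RHS]exprMn dft_abs_sqr /cr /ci; ring. Qed.

Lemma c_lt1 d t : cr d t ^+ 2 + ci d t ^+ 2 < 1.
Proof.
rewrite c_sqr expr_lt1 ?eta_dft_abs_lt1//.
by rewrite mulr_ge0 ?dft_abs_ge0// ltW// eta_gt0.
Qed.

Let gap0 d := energy d 0%N ^+ 2 - (Wr d 0%N ^+ 2 + Wi d 0%N ^+ 2).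

(** Because the gap never exceeds its initial value, the energy and [|w^[d]|] differ by a bounded
    amount. *)
Lemma energy_le d t : energy d t <= dft_abs (w t) d + Num.sqrt (gap0 d).
Proof.
have g0 : 0 <= gap0 d by rewrite subr_ge0 W_le_energy.
rewrite -ler_sqr ?nnegrE ?addr_ge0 ?energy_ge0 ?sqrtr_ge0//.
have := gap_le_initial R (energy d) (Wr d) (Wi d) (cr d) (ci d) (W_lt_energy0 d) (c_lt1 d)
  (energy_rec d) (Wr_rec d) (Wi_rec d) t.
rewrite -/(gap0 d) sqrrD dft_abs_sqr sqr_sqrtr//.
have := mulr_ge0 (dft_abs_ge0 R D (w t) d) (sqrtr_ge0 (gap0 d)).
rewrite /Wr /Wi; lra.
Qed.

Lemma dot_u_energy t : dot (u t) (u t) = 2 * \sum_(d < D) energy d t.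
Proof.
have -> : dot (u t) (u t) = dot (lsubmx (u t)) (lsubmx (u t)) + dot (rsubmx (u t)) (rsubmx (u t)).
  by rewrite -dot_row_mx hsubmxK.
rewrite !parseval mulr_sumr -big_split/=; apply: eq_bigr => d _.
by rewrite /energy; field.
Qed.

Lemma norm2_w_le_energy t : norm2 (w t) <= \sum_(d < D) energy d t.
Proof.
have s0 : 0 <= \sum_(d < D) energy d t by apply: sumr_ge0 => d _; exact: energy_ge0.
rewrite -ler_sqr ?nnegrE ?norm2_ge0// norm2_sqr parseval expr2 mulr_suml.
apply: ler_sum => d _; rewrite -!expr2.
apply: (le_trans (W_le_energy d t)).
rewrite expr2 ler_wpM2l ?energy_ge0// (bigD1 d)//= lerDl.
by apply: sumr_ge0 => e _; exact: energy_ge0.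
Qed.

Let E t := \sum_(n < N) expR (- (y n * dot (X n) (w t))).
Let CX := \sum_(n < N) `|y n| * norm2 (X n).

Lemma norm2_z_le t : norm2 (z t) <= CX * E t.
Proof.
have C0 : 0 <= CX by apply: sumr_ge0 => n _; rewrite mulr_ge0// norm2_ge0.
have E0 : 0 <= E t by apply: sumr_ge0 => n _; exact: expR_ge0.
have [->|z0] := eqVneq (norm2 (z t)) 0; first by rewrite mulr_ge0.
have zp : 0 < norm2 (z t) by rewrite lt_neqAle eq_sym z0 norm2_ge0.
rewrite -(ler_pM2l zp) -expr2 norm2_sqr {1}/z dot_negloss_grad.
have -> : norm2 (z t) * (CX * E t) = \sum_(n < N) norm2 (z t) * (`|y n| * norm2 (X n)) * E t.
  by rewrite mulrA -mulr_suml -mulr_sumr.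
apply: ler_sum => n _.
have e0 := expR_ge0 (- (y n * dot (X n) (w t))).
have eE : expR (- (y n * dot (X n) (w t))) <= E t.
  by rewrite /E (bigD1 n)//= lerDl sumr_ge0// => k _; exact: expR_ge0.
have q0 : 0 <= norm2 (z t) * (`|y n| * norm2 (X n)) by rewrite !mulr_ge0 ?norm2_ge0.
apply: le_trans (ler_wpM2l q0 eE); rewrite ler_wpM2r//.
apply: le_trans (ler_norm _) _; rewrite normrM mulrCA ler_wpM2l//.
by rewrite mulrC cauchy_schwarz_norm.
Qed.

Hypothesis loss_cvg0 : (fun t => Lconv X y (u t)) @ \oo --> 0.
Variable wbar : 'rV[R]_D.
Hypothesis dir_w : (fun t => dir (w t)) @ \oo --> wbar.
Hypothesis margin_wbar : forall n, 0 < y n * dot (X n) wbar.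

(** A single exponential term of the loss is bounded below as long as the weights stay bounded. *)
Lemma norm2_w_unbounded (C : R) : \forall t \near \oo, C <= norm2 (w t).
Proof.
pose n0 := Ordinal N_gt0.
pose a := `|y n0| * norm2 (X n0) + 1.
have a0 : 0 < a by rewrite ltr_wpDl// mulr_ge0// norm2_ge0.
have e0 : 0 < expR (- (a * (`|C| + 1))) by exact: expR_gt0.
apply: filterS (cvgr0_norm_le _ loss_cvg0 _ e0) => t Ht; rewrite leNgt; apply/negP => wC.
have := le_trans (ler_norm _) Ht; rewrite leNgt => /negP; apply.
rewrite /Lconv /Lw (bigD1 n0)//=.
apply: (@lt_le_trans _ _ (expR (- (y n0 * dot (X n0) (w t))))); last first.
  by rewrite lerDl sumr_ge0// => k _; exact: expR_ge0.
rewrite ltr_expR ltrN2.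
have wC' : norm2 (w t) <= `|C| by rewrite (le_trans (ltW wC))// ler_norm.
have cs : y n0 * dot (X n0) (w t) <= `|y n0| * norm2 (X n0) * norm2 (w t).
  by apply: le_trans (ler_norm _) _; rewrite normrM -mulrA ler_wpM2l// cauchy_schwarz_norm.
apply: (le_lt_trans cs).
have q0 : 0 <= `|y n0| * norm2 (X n0) by rewrite mulr_ge0// norm2_ge0.
have := ler_wpM2l q0 wC'; rewrite /a; have := normr_ge0 C.
have := mulr_ge0 q0 (normr_ge0 C); lra.
Qed.


Lemma norm2_w_gt0 : \forall t \near \oo, 0 < norm2 (w t).
Proof. by apply: filterS (norm2_w_unbounded 1) => t; exact: lt_le_trans. Qed.

Lemma margin_growth n (a : R) : a < y n * dot (X n) wbar ->
  \forall t \near \oo, a * norm2 (w t) <= y n * dot (X n) (w t).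
Proof.
move=> am.
have cv : (fun t => y n * dot (X n) (dir (w t))) @ \oo --> y n * dot (X n) wbar.
  by apply: cvgMl_tmp; exact: cvg_dot.
near=> t.
have H : a <= y n * dot (X n) (dir (w t)) by near: t; exact: (cvgr_ge _ cv _ am).
rewrite {2}(norm2_dir _ _ (w t)) dotZr mulrCA [leLHS]mulrC ler_wpM2l// norm2_ge0.
Unshelve. all: by end_near. Qed.

Lemma exists_min_margin : exists n0, forall n, y n0 * dot (X n0) wbar <= y n * dot (X n) wbar.
Proof.
case: (@arg_minP _ _ _ (Ordinal N_gt0) xpredT (fun n => y n * dot (X n) wbar) isT) => n0 _ H.
by exists n0 => n; exact: H.
Qed.

Lemma exists_margin : exists2 g : R, 0 < g &
  \forall t \near \oo, forall n, g * norm2 (w t) <= y n * dot (X n) (w t).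
Proof.
have [n0 n0min] := exists_min_margin.
exists (y n0 * dot (X n0) wbar / 2); first by rewrite divr_gt0.
apply: filter_forall => n; apply: margin_growth; apply: lt_le_trans (n0min n).
by rewrite ltr_pdivrMr// ltr_pMr// ltr1n.
Qed.

Lemma h_ge0 t : 0 <= h t.
Proof. by rewrite mulr_ge0 ?norm2_ge0// ltW// eta_gt0. Qed.

(* The second derivative of the loss in the direction [u] is of order
   [|w| ^+ 2 * loss], while [|u| ^+ 2] is only of order [|w|] because [energy_gap]
   is bounded; hence the step size is [O (1 / (|w| * loss))]. *)
Lemma h_cvg0 : h @ \oo --> 0.
Proof.
have [g g0 Hg] := exists_margin.
(* Chosen so that [dot u u = 2 * \sum energy <= C2 * norm2 w] once [norm2 w >= 1]; the final 1 makes
   it positive. *)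
pose C2 := 2 * D%:R + 2 * \sum_(d < D) Num.sqrt (gap0 d) + 1.
have sq0 : 0 <= \sum_(d < D) Num.sqrt (gap0 d) by apply: sumr_ge0 => d _; exact: sqrtr_ge0.
have C20 : 0 < C2.
  by rewrite /C2; have := ler0n R D; lra.
have CX0 : 0 <= CX by apply: sumr_ge0 => n _; rewrite mulr_ge0// norm2_ge0.
apply/cvgr0Pnorm_le => eps e0; near=> t.
have w1 : 1 <= norm2 (w t) by near: t; exact: norm2_w_unbounded.
(* All margins are then at least 1, hence [4 m^2 - 2 m >= 2 m^2]. *)
have wg : g^-1 <= norm2 (w t) by near: t; exact: norm2_w_unbounded.
have we : CX * C2 / (2 * g ^+ 2) / eps <= norm2 (w t) by near: t; exact: norm2_w_unbounded.
have mg : forall n, g * norm2 (w t) <= y n * dot (X n) (w t) by near: t; exact: Hg.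
have [et0 [r [beta [r0 [Lip eb]]]]] := step t.
have H1 : 2 * (g * norm2 (w t)) ^+ 2 * E t <= beta * dot (u t) (u t).
  apply: le_trans (lipschitz_ge_margins _ _ _ _ _ _ _ _ r0 Lip).
  rewrite /E mulr_sumr; apply: ler_sum => n _; rewrite -/(w t) ler_wpM2r ?expR_ge0//.
  have gw1 : 1 <= g * norm2 (w t) by rewrite -ler_pdivrMl// mulr1.
  have := mg n; move: (y n * dot (X n) (w t)) (g * norm2 (w t)) gw1 => m q q1 qm.
  have : q ^+ 2 <= m ^+ 2 by rewrite ler_sqr ?nnegrE//; lra.
  nra.
have D0 : (0 < D)%N.
  case: (D) (w t) w1 => // w0; rewrite /norm2 /dot big_ord0 sqrtr0 ler10//.
have b0 : 0 <= beta.
  apply: le_trans (lipschitz_ge_dft_abs _ _ _ _ _ _ _ _ (Ordinal D0) r0 Lip).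
  exact: dft_abs_ge0.
have H2 : dot (u t) (u t) <= C2 * norm2 (w t).
  rewrite dot_u_energy.
  have : \sum_(d < D) energy d t <= \sum_(d < D) (norm2 (w t) + Num.sqrt (gap0 d)).
    apply: ler_sum => d _; apply: (le_trans (energy_le d t)).
    by rewrite lerD2r dft_abs_le_norm2.
  rewrite big_split/= sumr_const card_ord -[norm2 _ *+ _]mulr_natl => H2.
  have := ler_wpM2l sq0 w1; rewrite /C2; lra.
have w0 : 0 < norm2 (w t) by exact: lt_le_trans w1.
have E0 : 0 <= E t by apply: sumr_ge0 => n _; exact: expR_ge0.
have H3 : 2 * g ^+ 2 * norm2 (w t) * E t <= beta * C2.
  rewrite -(ler_pM2r w0); apply: le_trans (_ : beta * dot (u t) (u t) <= _); last first.
    by rewrite -mulrA ler_wpM2l.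
  by apply: le_trans H1; rewrite le_eqVlt; apply/orP; left; apply/eqP; ring.
have H4 : eta t * (2 * g ^+ 2 * norm2 (w t) * E t) <= C2.
  apply: (le_trans (ler_wpM2l (ltW et0) H3)); rewrite mulrA ler_piMl// ltW//.
rewrite ger0_norm ?h_ge0//.
have gg0 : 0 < 2 * g ^+ 2 by rewrite mulr_gt0// exprn_gt0.
have H5 : h t * (2 * g ^+ 2 * norm2 (w t)) <= CX * C2.
  apply: (@le_trans _ _ (eta t * (CX * E t) * (2 * g ^+ 2 * norm2 (w t)))).
    apply: ler_wpM2r; first by rewrite mulr_ge0 ?norm2_ge0// ltW.
    by apply: ler_wpM2l; [exact: ltW|exact: norm2_z_le].
  have := ler_wpM2l CX0 H4; lra.
move: we; rewrite ler_pdivrMr// ler_pdivrMr// => we.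
have p0 : 0 < 2 * g ^+ 2 * norm2 (w t) by rewrite mulr_gt0.
rewrite -(ler_pM2r p0); apply: (le_trans H5).
apply: (le_trans we).
by rewrite le_eqVlt; apply/orP; left; apply/eqP; ring.
Unshelve. all: by end_near. Qed.

Lemma energy_rec_le d t : energy d t.+1 <= (1 + (h t ^+ 2 + 2 * h t)) * energy d t.
Proof.
have e0 := energy_ge0 d t.
have ch : eta t * dft_abs (z t) d <= h t.
  by rewrite ler_wpM2l ?dft_abs_le_norm2// ltW// eta_gt0.
have c0 : 0 <= eta t * dft_abs (z t) d.
  by rewrite mulr_ge0 ?dft_abs_ge0// ltW// eta_gt0.
have H1 : cr d t * Wr d t + ci d t * Wi d t <= h t * energy d t.
  apply: le_trans (ler_norm _) _; apply: dot2_le_norm; rewrite ?h_ge0//.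
    by rewrite c_sqr ler_sqr ?nnegrE ?h_ge0.
  exact: W_le_energy.
have H2 : cr d t ^+ 2 + ci d t ^+ 2 <= h t ^+ 2 by rewrite c_sqr ler_sqr ?nnegrE ?h_ge0.
rewrite energy_rec; have := ler_wpM2r e0 H2; lra.
Qed.

(** The total energy dominates [norm2 w], hence is unbounded; the constant 3 comes from
    [h^2 + 2 h <= 3 h] for [h <= 1]. *)
Lemma h_diverges : series_diverges R h.
Proof.
apply: (unbounded_series_diverges R h h_ge0 3 (fun t => \sum_(d < D) energy d t)) => //.
- by move=> t; apply: sumr_ge0 => d _; exact: energy_ge0.
- near=> t.
  have h1 : h t <= 1.
    apply: le_trans (ler_norm _) _; near: t.
    exact: (cvgr0_norm_le h h_cvg0 1 ltr01).
  rewrite mulr_sumr; apply: ler_sum => d _.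
  apply: (le_trans (energy_rec_le d t)); rewrite ler_wpM2r ?energy_ge0//.
  have := h_ge0 t; nra.
- by move=> M; apply: filterS (norm2_w_unbounded M) => t /le_trans; apply; exact: norm2_w_le_energy.
Unshelve. all: by end_near. Qed.

(** * Consequences of the convergence of the gradient direction *)

Variable zbar : 'rV[R]_D.
Hypothesis dir_z : (fun t => dir (z t)) @ \oo --> zbar.

Lemma c_asymp d (eps : R) : 0 < eps -> \forall t \near \oo,
  (cr d t - h t * dft_re zbar d) ^+ 2 + (ci d t - h t * dft_im zbar d) ^+ 2 <= (eps * h t) ^+ 2.
Proof.
move=> e0; have e20 : 0 < eps / 2 by rewrite divr_gt0.
near=> t.
have Hr : `|dft_re (dir (z t)) d - dft_re zbar d| <= eps / 2.
  by near: t; exact: (cvgr_distC_le _ _ (cvg_dft_re _ _ _ _ d dir_z) _ e20).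
have Hi : `|dft_im (dir (z t)) d - dft_im zbar d| <= eps / 2.
  by near: t; exact: (cvgr_distC_le _ _ (cvg_dft_im _ _ _ _ d dir_z) _ e20).
have -> : cr d t = h t * dft_re (dir (z t)) d.
  by rewrite /cr /h {1}(norm2_dir _ _ (z t)) dft_reZ mulrA.
have -> : ci d t = h t * dft_im (dir (z t)) d.
  by rewrite /ci /h {1}(norm2_dir _ _ (z t)) dft_imZ mulrA.
move: (dft_re (dir (z t)) d) (dft_im (dir (z t)) d) (h t) Hr Hi => a b q Hr Hi.
have -> : (q * a - q * dft_re zbar d) ^+ 2 + (q * b - q * dft_im zbar d) ^+ 2 =
  ((a - dft_re zbar d) ^+ 2 + (b - dft_im zbar d) ^+ 2) * q ^+ 2 by ring.
rewrite [leRHS]exprMn; apply: ler_wpM2r; first exact: sqr_ge0.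
have sq (x : R) : `|x| <= eps / 2 -> x ^+ 2 <= (eps / 2) ^+ 2.
  by move=> ?; rewrite -real_normK ?num_real// ler_sqr ?nnegrE// ltW.
have := sq _ Hr; have := sq _ Hi.
have := sqr_ge0 eps; lra.
Unshelve. all: by end_near. Qed.

(** The reverse of Cauchy-Schwarz at frequency [d]: along the trajectory it holds up to a factor
    [1 - eps], and dividing by [norm2 w] passes to the limit direction. *)
Lemma phase_alignment_limit d :
  dft_abs zbar d * dft_abs wbar d <= dft_re zbar d * dft_re wbar d + dft_im zbar d * dft_im wbar d.
Proof.
set rho := dft_abs zbar d.
have rhoE : dft_re zbar d ^+ 2 + dft_im zbar d ^+ 2 = rho ^+ 2 by rewrite dft_abs_sqr.
have rho0 : 0 <= rho by exact: dft_abs_ge0.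
have [r0|r0] := eqVneq rho 0.
  move: rhoE; rewrite r0 mul0r expr0n/= => /eqP.
  rewrite paddr_eq0 ?sqr_ge0// !sqrf_eq0 => /andP[/eqP-> /eqP->].
  by rewrite !mul0r addr0.
have rp : 0 < rho by rewrite lt_neqAle eq_sym r0.
have lim (eps : R) : 0 < eps -> eps <= 1 ->
    (1 - eps) * (rho * dft_abs wbar d) <= dft_re zbar d * dft_re wbar d + dft_im zbar d * dft_im wbar d.
  move=> e0 e1; rewrite -subr_ge0.
  apply: (cvg_ge_near _ (fun t => dft_re zbar d * dft_re (dir (w t)) d
     + dft_im zbar d * dft_im (dir (w t)) d - (1 - eps) * (rho * dft_abs (dir (w t)) d))).
    apply: cvgB; first by apply: cvgD; apply: cvgMl_tmp; [exact: cvg_dft_re|exact: cvg_dft_im].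
    by apply: cvgMl_tmp; apply: cvgMl_tmp; exact: cvg_dft_abs.
  have PA := phase_alignment R h (energy d) (Wr d) (Wi d) (cr d) (ci d) _ _ rho h_ge0 h_cvg0
    h_diverges (energy_ge0 d) (W_le_energy d) (W_lt_energy0 d) (c_lt1 d) (energy_rec d)
    (Wr_rec d) (Wi_rec d) (c_asymp d) rho0 rhoE rp eps e0.
  near=> t.
  have w0 : 0 < norm2 (w t) by near: t; exact: norm2_w_gt0.
  have H : (1 - eps) * (rho * energy d t) <= dft_re zbar d * Wr d t + dft_im zbar d * Wi d t.
    by near: t; exact: PA.
  have {}H : (1 - eps) * (rho * dft_abs (w t) d) <= dft_re zbar d * Wr d t + dft_im zbar d * Wi d t.
    apply: le_trans H; rewrite ler_wpM2l ?subr_ge0// ler_wpM2l//.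
    exact: dft_abs_w_le_energy.
  rewrite -(pmulr_rge0 _ w0); move: H; rewrite /Wr /Wi.
  rewrite (norm2_dir _ _ (w t)) dft_absZ ?norm2_ge0// dft_reZ dft_imZ.
  rewrite -(norm2_dir _ _ (w t)); lra.
rewrite leNgt; apply/negP => lt.
set a := rho * dft_abs wbar d in lt lim.
set b := _ + _ in lt lim.
have a0 : 0 <= a by rewrite mulr_ge0 ?dft_abs_ge0.
pose e := Num.min 1 ((a - b) / (2 * (a + 1))).
have q0 : 0 < 2 * (a + 1) by lra.
have e0 : 0 < e by rewrite lt_min ltr01 divr_gt0// subr_gt0.
have e1 : e <= 1 by rewrite ge_min lexx.
have e2 : e * (2 * (a + 1)) <= a - b by rewrite -ler_pdivlMr// ge_min lexx orbT.
have := lim e e0 e1; have := mulr_ge0 (ltW e0) a0; lra.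
Unshelve. all: by end_near. Qed.

(** The energy at [d] is divided by the expanding coordinate at [e], for which a lower growth bound
    is available; the ratio contracts along the divergent series, and alignment bounds the
    denominator by a multiple of [norm2 w]. *)
Lemma nonmaximal_frequency_vanishes d e :
  dft_abs zbar d < dft_abs zbar e -> dft_abs wbar d = 0.
Proof.
set rho := dft_abs zbar d; set M := dft_abs zbar e => rM.
have rhoE : dft_re zbar d ^+ 2 + dft_im zbar d ^+ 2 = rho ^+ 2 by rewrite dft_abs_sqr.
have ME : dft_re zbar e ^+ 2 + dft_im zbar e ^+ 2 = M ^+ 2 by rewrite dft_abs_sqr.
have rho0 : 0 <= rho by exact: dft_abs_ge0.
have M0 : 0 < M by exact: le_lt_trans rM.
pose A t := M * energy e t + (dft_re zbar e * Wr e t + dft_im zbar e * Wi e t).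
have Agt0 t : 0 < A t.
  have gap := gap_gt0 R (energy e) (Wr e) (Wi e) (cr e) (ci e) (W_lt_energy0 e) (c_lt1 e)
   (energy_rec e) (Wr_rec e) (Wi_rec e) t.
  have lt : dft_abs (w t) e < energy e t.
    rewrite -ltr_sqr ?nnegrE ?dft_abs_ge0 ?energy_ge0// dft_abs_sqr -subr_gt0.
    exact: gap.
  have : `|dft_re zbar e * Wr e t + dft_im zbar e * Wi e t| <= M * dft_abs (w t) e.
    apply: dot2_le_norm; rewrite ?dft_abs_ge0 ?(ltW M0) ?ME//.
    by rewrite dft_abs_sqr.
  rewrite ler_norml => /andP[H _].
  have : M * dft_abs (w t) e < M * energy e t by rewrite ltr_pM2l.
  rewrite /A; lra.
pose del := M - rho.
have del0 : 0 < del by rewrite subr_gt0.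
have d80 : 0 < del / 8 by rewrite divr_gt0.
have up := S_growth_le R h (energy d) (Wr d) (Wi d) (cr d) (ci d) _ _ rho h_ge0 h_cvg0
    (energy_ge0 d) (W_le_energy d) (energy_rec d) (c_asymp d) rho0 rhoE _ d80.
have dn := S_growth_ge R h (energy e) (Wr e) (Wi e) (cr e) (ci e) _ _ M h_ge0 h_cvg0
    h_diverges (energy_ge0 e) (W_le_energy e) (W_lt_energy0 e) (c_lt1 e) (energy_rec e)
    (Wr_rec e) (Wi_rec e) (c_asymp e) (ltW M0) ME M0 _ d80.
have half0 : 0 < 2^-1 :> R by rewrite invr_gt0.
have PA := phase_alignment R h (energy e) (Wr e) (Wi e) (cr e) (ci e) _ _ M h_ge0 h_cvg0
    h_diverges (energy_ge0 e) (W_le_energy e) (W_lt_energy0 e) (c_lt1 e) (energy_rec e)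
    (Wr_rec e) (Wi_rec e) (c_asymp e) (ltW M0) ME M0 _ half0.
have Y0 t : 0 <= energy d t / A t by rewrite divr_ge0 ?energy_ge0// ltW.
have d20 : 0 < del / 2 by rewrite divr_gt0.
(* This bound on [h] keeps the second-order loss, at most [del * M * h^2], below the first-order
   surplus [del * h] left by the tolerances [del / 8] and the rate [del / 2]. *)
have m10 : 0 < (M + 1)^-1 by rewrite invr_gt0 addr_gt0.
have Yrec : \forall t \near \oo,
    energy d t.+1 / A t.+1 <= (1 - del / 2 * h t) * (energy d t / A t).
  near=> t.
  have U : energy d t.+1 <= (1 + 2 * (rho + del / 8) * h t) * energy d t by near: t; exact: up.
  have L : (1 + 2 * (M - del / 8) * h t) * A t <= A t.+1 by near: t; exact: dn.
  have mh : h t <= (M + 1)^-1.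
    apply: le_trans (ler_norm _) _; near: t.
    exact: (cvgr0_norm_le h h_cvg0 _ m10).
  have mh1 : (M + 1) * h t <= 1 by rewrite -ler_pdivlMl ?mulr1// addr_gt0.
  have h0 := h_ge0 t.
  rewrite mulrA ler_pdivrMr// mulrAC ler_pdivlMr//.
  have rE : rho = M - del by rewrite /del; ring.
  have dM : del <= M by rewrite /del gerBl.
  have k0 : 0 <= 1 - del / 2 * h t by nra.
  have q : 1 + 2 * (rho + del / 8) * h t <=
      (1 - del / 2 * h t) * (1 + 2 * (M - del / 8) * h t).
    rewrite rE.
    have p1 : 0 <= del * h t by rewrite mulr_ge0// ltW.
    have p2 := ler_wpM2l p1 mh1.
    have p3 : 0 <= del * h t * (del * h t) by rewrite mulr_ge0.
    have p4 : 0 <= del * h t * h t by rewrite mulr_ge0.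
    lra.
  apply: (@le_trans _ _ ((1 + 2 * (rho + del / 8) * h t) * energy d t * A t)).
    by rewrite ler_wpM2r// ltW.
  apply: (@le_trans _ _ ((1 - del / 2 * h t) * energy d t * ((1 + 2 * (M - del / 8) * h t) * A t))).
    have ea := mulr_ge0 (energy_ge0 d t) (ltW (Agt0 t)).
    have := ler_wpM2r ea q; lra.
  by rewrite ler_wpM2l// mulr_ge0// energy_ge0.
have Ysmall := contraction_le_eps R h h_ge0 _ _ h_diverges d20 Y0 Yrec.
apply/eqP; rewrite eq_le dft_abs_ge0 andbT leNgt; apply/negP => wp.
(* Together with [A <= 4 * M * norm2 w] this gives half of the limit value, a contradiction. *)
pose eps := dft_abs wbar d / (8 * M).
have eps0 : 0 < eps by rewrite divr_gt0// mulr_gt0.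
suff : dft_abs wbar d <= dft_abs wbar d / 2 by lra.
apply: (cvg_le_near _ (fun t => dft_abs (dir (w t)) d)); first exact: cvg_dft_abs.
near=> t.
have w0 : 0 < norm2 (w t) by near: t; exact: norm2_w_gt0.
have Yt : energy d t / A t <= eps by near: t; exact: Ysmall.
have P : (1 - 2^-1) * (M * energy e t) <= dft_re zbar e * Wr e t + dft_im zbar e * Wi e t.
  by near: t; exact: PA.
have cs : dft_re zbar e * Wr e t + dft_im zbar e * Wi e t <= M * dft_abs (w t) e.
  apply: le_trans (ler_norm _) _; apply: dot2_le_norm; rewrite ?dft_abs_ge0 ?(ltW M0) ?ME//.
  by rewrite dft_abs_sqr.
have A4 : A t <= 4 * M * norm2 (w t).
  have : M * dft_abs (w t) e <= M * norm2 (w t) by rewrite ler_wpM2l ?dft_abs_le_norm2// ltW.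
  have : 0 <= M * norm2 (w t) by rewrite mulr_ge0// ltW.
  rewrite /A; lra.
rewrite ler_pdivrMr// in Yt.
have : dft_abs (w t) d <= eps * (4 * M * norm2 (w t)).
  apply: le_trans (dft_abs_w_le_energy d t) _; apply: (le_trans Yt).
  by rewrite ler_wpM2l// ltW.
rewrite {1}(norm2_dir _ _ (w t)) dft_absZ ?norm2_ge0//.
have -> : eps * (4 * M * norm2 (w t)) = norm2 (w t) * (dft_abs wbar d / 2).
  rewrite /eps; have nz := lt0r_neq0 M0; by field.
by rewrite ler_pM2l.
Unshelve. all: by end_near. Qed.

Lemma wbar_unit : dot wbar wbar = 1.
Proof.
have cv := cvg_dot_self _ _ _ _ dir_w.
apply/eqP; rewrite eq_le; apply/andP; split.
  apply: (cvg_le_near _ _ _ _ cv); apply: filterS norm2_w_gt0 => t w0.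
  by rewrite dot_dir// gt_eqF.
apply: (cvg_ge_near _ _ _ _ cv); apply: filterS norm2_w_gt0 => t w0.
by rewrite dot_dir// gt_eqF.
Qed.

(** Paired with [wbar], every sample contributes positively to [z]. *)
Lemma norm2_z_gt0 t : 0 < norm2 (z t).
Proof.
rewrite lt_neqAle norm2_ge0 andbT eq_sym; apply/negP => /eqP n0.
have : 0 < dot (z t) wbar.
  rewrite /z dot_negloss_grad (bigD1 (Ordinal N_gt0))//=.
  apply: ltr_pwDl; first by rewrite mulr_gt0// expR_gt0.
  by apply: sumr_ge0 => n _; rewrite mulr_ge0 ?expR_ge0// ltW.
by have := cauchy_schwarz _ _ (z t) wbar; rewrite n0 mul0r leNgt => /negbTE->.
Qed.

Lemma zbar_unit : dot zbar zbar = 1.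
Proof.
have cv := cvg_dot_self _ _ _ _ dir_z.
apply/eqP; rewrite eq_le; apply/andP; split.
  apply: (cvg_le_near _ _ _ _ cv); apply: nearW => t.
  by rewrite dot_dir// gt_eqF// norm2_z_gt0.
apply: (cvg_ge_near _ _ _ _ cv); apply: nearW => t.
by rewrite dot_dir// gt_eqF// norm2_z_gt0.
Qed.

Lemma dot_zbar_wbar (M : R) : (exists e, dft_abs zbar e = M) ->
  (forall d, dft_abs zbar d <= M) -> M * fourier_l1 wbar <= dot zbar wbar.
Proof.
move=> [e eM] zM; rewrite parseval /fourier_l1 mulr_sumr; apply: ler_sum => d _.
apply: le_trans (phase_alignment_limit d).
have := zM d; rewrite le_eqVlt => /orP[/eqP-> //|lt].
by rewrite (nonmaximal_frequency_vanishes d e) ?mulr0// eM.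
Qed.

(* The weights [expR (- margin)] concentrate on the samples of minimal margin. *)
Lemma nonsupport_weight_small (n n0 : 'I_N) (eps : R) : 0 < eps ->
  y n0 * dot (X n0) wbar < y n * dot (X n) wbar ->
  \forall t \near \oo, expR (- (y n * dot (X n) (w t))) <= eps * norm2 (z t).
Proof.
move=> e0 lt.
set a := y n0 * dot (X n0) wbar in lt; set b := y n * dot (X n) wbar in lt.
have a0 : 0 < a by exact: margin_wbar.
have cv : (fun t => y n * dot (X n) (dir (w t)) - y n0 * dot (X n0) (dir (w t))) @ \oo --> b - a.
  by apply: cvgB; apply: cvgMl_tmp; exact: cvg_dot.
have k0 : 0 < (b - a) / 2 by rewrite divr_gt0// subr_gt0.
have kl : (b - a) / 2 < b - a by rewrite ltr_pdivrMr// ltr_pMr ?ltr1n// subr_gt0.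
near=> t.
have w0 : 0 < norm2 (w t) by near: t; exact: norm2_w_gt0.
have we : ((b - a) / 2 * (eps * a))^-1 <= norm2 (w t) by near: t; exact: norm2_w_unbounded.
have H : (b - a) / 2 <= y n * dot (X n) (dir (w t)) - y n0 * dot (X n0) (dir (w t)).
  by near: t; exact: (cvgr_ge _ cv _ kl).
(* [wbar] is a unit vector with positive margins, so [norm2 z] dominates the contribution of the
   sample [n0] to [dot z wbar]. *)
have za : a * expR (- (y n0 * dot (X n0) (w t))) <= norm2 (z t).
  have : dot (z t) wbar <= norm2 (z t).
    apply: le_trans (cauchy_schwarz _ _ _ _) _.
    by rewrite {2}/norm2 wbar_unit sqrtr1 mulr1.
  apply: le_trans; rewrite /z dot_negloss_grad (bigD1 n0)//= lerDl sumr_ge0// => k _.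
  by rewrite mulr_ge0 ?expR_ge0// ltW.
apply: (@le_trans _ _ (eps * (a * expR (- (y n0 * dot (X n0) (w t)))))); last first.
  by rewrite ler_wpM2l// ltW.
have mE : y n * dot (X n) (w t) = y n0 * dot (X n0) (w t) +
    norm2 (w t) * (y n * dot (X n) (dir (w t)) - y n0 * dot (X n0) (dir (w t))).
  have dE k : dot (X k) (w t) = norm2 (w t) * dot (X k) (dir (w t)).
    by rewrite {1}(norm2_dir _ _ (w t)) dotZr.
  by rewrite !dE; ring.
rewrite mE opprD expRD mulrA mulrC ler_wpM2r ?expR_ge0//.
rewrite expRN.
have ea0 : 0 < eps * a by rewrite mulr_gt0.
have x0 : 0 < (b - a) / 2 * (eps * a) by rewrite mulr_gt0.
rewrite -[leRHS]invrK lef_pV2 ?posrE ?expR_gt0 ?invr_gt0//.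
(* The margin difference grows linearly with [norm2 w], so the bound [1 + x <= expR x] is enough. *)
apply: le_trans (expR_ge1Dx _).
have : (eps * a)^-1 <= norm2 (w t) * ((b - a) / 2).
  by move: we; rewrite invfM mulrC ler_pdivrMr// mulrC.
have : norm2 (w t) * ((b - a) / 2) <=
   norm2 (w t) * (y n * dot (X n) (dir (w t)) - y n0 * dot (X n0) (dir (w t))).
  by rewrite ler_wpM2l// ltW.
lra.
Unshelve. all: by end_near. Qed.

(** Complementary slackness in the limit. Feasibility of [v] bounds [dot z (ws - v)] by the weighted
    slacks of [ws], the rescaled [wbar]; a slack is 0 at samples of minimal margin, and elsewhere
    its weight is [o(norm2 z)]. *)
Lemma zbar_minimizes (n0 : 'I_N) (v : 'rV[R]_D) :
  (forall n, y n0 * dot (X n0) wbar <= y n * dot (X n) wbar) ->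
  (forall n, 1 <= y n * dot (X n) v) ->
  dot zbar ((y n0 * dot (X n0) wbar)^-1 *: wbar) <= dot zbar v.
Proof.
move=> n0min vfeas; set a := y n0 * dot (X n0) wbar in n0min *.
have a0 : 0 < a by exact: margin_wbar.
have Np : 0 < N%:R :> R by rewrite ltr0n.
rewrite -subr_le0; apply/ler_addgt0Pr => eps e0; rewrite add0r.
pose ws := a^-1 *: wbar.
have fE x : dot x ws - dot x v = dot (ws + (-1) *: v) x.
  by rewrite dotDl !(dotC _ _ _ x) mulN1r.
apply: (cvg_le_near _ (fun t => dot (ws + (-1) *: v) (dir (z t)))).
  by rewrite -/ws fE; exact: cvg_dot.
near=> t.
have z0 := norm2_z_gt0 t.
have small : forall n, (y n * dot (X n) ws - 1) * expR (- (y n * dot (X n) (w t))) <=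
    eps / N%:R * norm2 (z t).
  near: t; apply: filter_forall => n.
  have muE : y n * dot (X n) ws - 1 = (y n * dot (X n) wbar - a) / a.
    by rewrite dotZr; have nz := lt0r_neq0 a0; field.
  have eN : 0 < eps / N%:R by rewrite divr_gt0.
  have := n0min n; rewrite le_eqVlt => /orP[/eqP aE|lt].
    by apply: nearW => t; rewrite muE -aE subrr !mul0r mulr_ge0 ?norm2_ge0// ltW.
  have mu0 : 0 < y n * dot (X n) ws - 1 by rewrite muE divr_gt0// subr_gt0.
  have em0 : 0 < eps / N%:R / (y n * dot (X n) ws - 1) by rewrite divr_gt0.
  apply: filterS (nonsupport_weight_small n n0 _ em0 lt) => t Ht.
  rewrite -ler_pdivlMl//; apply: (le_trans Ht).
  by rewrite le_eqVlt; apply/orP; left; apply/eqP; ring.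
rewrite -(ler_pM2l z0) -dotZr -(norm2_dir _ _ (z t)) dotDl !(dotC _ _ _ (z t)).
rewrite /z !dot_negloss_grad mulN1r -sumrB.
have -> : norm2 (z t) * eps = \sum_(n < N) eps / N%:R * norm2 (z t).
  by rewrite sumr_const card_ord -[RHS]mulr_natr; have nz := lt0r_neq0 Np; field.
apply: ler_sum => n _; apply: le_trans (small n).
rewrite -mulrBl ler_wpM2r ?expR_ge0// lerD2l lerN2; exact: vfeas.
Unshelve. all: by end_near. Qed.


End GradientDescent.

Theorem theorem2 (R : realType) (D N : nat) (hD : (0 < D)%N) (hN : (0 < N)%N)
  (y : 'I_N -> R) (hy : forall n, y n = 1 \/ y n = -1) :
  (* almost all datasets X (rows x_n) *)
  exists Zdata : set 'M[R]_(N, D), leb_null Zdata /\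
  forall X : 'M[R]_(N, D), ~ Zdata X ->
  (* linearly separable *)
  (exists w : 'rV[R]_D, forall n, 0 < y n * dot (row n X) w) ->
  (* almost all initializations *)
  exists Zinit : set 'M[R]_(1, D + D), leb_null Zinit /\
  forall (u : nat -> 'rV[R]_(D + D)) (eta : nat -> R),
  ~ Zinit (u 0%N) ->
  (* step sizes below the inverse local Lipschitz constant of the gradient *)
  (forall t, 0 < eta t /\
     exists r beta, 0 < r /\
       grad_lipschitz_on (Lconv (fun n => row n X) y) (u t) r beta /\
       eta t * beta < 1) ->
  (* gradient descent *)
  (forall t, u t.+1 = u t - eta t *: grad (Lconv (fun n => row n X) y) (u t)) ->
  (* (a) *)
  (fun t => Lconv (fun n => row n X) y (u t)) @ \oo --> 0 ->
  (* (b) *)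
  cvg_dir u ->
  forall wbar : 'rV[R]_D,
  (fun t => dir (Pconv (u t))) @ \oo --> wbar ->
  (forall n, 0 < y n * dot (row n X) wbar) ->
  (* (c) *)
  (forall d : 'I_D, exists pr pi_ : R,
     (fun t => phase_re (Pconv (u t)) d) @ \oo --> pr /\
     (fun t => phase_im (Pconv (u t)) d) @ \oo --> pi_) ->
  (* (d) *)
  cvg_dir (fun t => grad (Lw (fun n => row n X) y) (Pconv (u t))) ->
  (* conclusion *)
  exists wstar : 'rV[R]_D,
    (forall n, 1 <= y n * dot wstar (row n X)) /\
    (forall w : 'rV[R]_D, (forall n, 1 <= y n * dot w (row n X)) ->
       fourier_l1 wstar <= fourier_l1 w) /\
    wbar = dir wstar.
Proof.
exists set0; split.
  (* The covering boxes are degenerate; their volume has a zero factor because [hN] and [hD] provide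
     a matrix entry. *)
  move=> eps e0; exists (fun=> 0), (fun=> 0); split; first by [].
  split=> [x []|K]; rewrite big1 // => k _.
  by rewrite /box_vol (bigD1 (Ordinal hN))//= (bigD1 (Ordinal hD))//= subrr !mul0r.
move=> X _ _; eexists; split; first exact: (balanced_null R D hD).
move=> u eta u0 step descent loss0 _ wbar dirw margin _ [l dirl].
have unb d : dft_re (lsubmx (u 0%N)) d ^+ 2 + dft_im (lsubmx (u 0%N)) d ^+ 2 <>
    dft_re (rsubmx (u 0%N)) d ^+ 2 + dft_im (rsubmx (u 0%N)) d ^+ 2.
  by move=> eq; apply: u0; exists d.
have dirz : (fun t => dir (negloss_grad R D N (fun n => row n X) y (Pconv (u t)))) @ \oo --> - l.
  have -> : (fun t => dir (negloss_grad R D N (fun n => row n X) y (Pconv (u t)))) =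
     (fun t => - dir (grad (Lw (fun n => row n X) y) (Pconv (u t)))).
    by apply/funext => t; rewrite grad_Lw /dir norm2N scalerN opprK.
  exact: cvgN.
have [n0 n0min] := exists_min_margin R D N (fun n => row n X) y hN wbar.
set a := y n0 * dot (row n0 X) wbar in n0min.
have a0 : 0 < a by exact: margin.
have w1 := wbar_unit R D N (fun n => row n X) y u hN loss0 _ dirw.
have z1 := zbar_unit R D N (fun n => row n X) y u hN wbar margin _ dirz.
exists (a^-1 *: wbar); split; [|split].
- by move=> n; rewrite dotC dotZr mulrCA -ler_pdivrMl ?invr_gt0// invrK mulr1.
- move=> v vfeas.
  have [e _ emax] := @arg_maxP _ _ _ (Ordinal hD) xpredT (fun d => dft_abs (- l) d) isT.
  (* A vanishing maximum would make the unit vector [- l] orthogonal to itself by duality. *)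
  have M0 : 0 < dft_abs (- l) e.
    rewrite lt_neqAle dft_abs_ge0 andbT eq_sym; apply/negP => /eqP e0.
    have : dot (- l) (- l) <= 0 * fourier_l1 (- l).
      by apply: dot_le_fourier_l1 => d; rewrite -e0; exact: emax.
    by rewrite z1 mul0r ler10.
  have H1 : dft_abs (- l) e * fourier_l1 wbar <= dot (- l) wbar.
    apply: (dot_zbar_wbar _ _ _ _ _ _ _ hN unb step descent loss0 _ dirw margin _ dirz) => //.
      by exists e.
    by move=> d; exact: emax.
  have H2 : dot (- l) (a^-1 *: wbar) <= dot (- l) v.
    apply: (zbar_minimizes _ _ _ _ _ _ hN loss0 _ dirw margin _ dirz) => // n.
    by rewrite dotC.
  have H3 : dot (- l) v <= dft_abs (- l) e * fourier_l1 v.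
    by apply: dot_le_fourier_l1 => d; exact: emax.
  (* The chain [M * l1 wbar / a <= dot zbar wbar / a <= dot zbar v <= M * l1 v] with [zbar = - l],
     divided by [M > 0]. *)
  rewrite -(ler_pM2l M0) fourier_l1Z ?invr_ge0 ?(ltW a0)// mulrCA.
  apply: le_trans H3; apply: le_trans H2; rewrite dotZr ler_wpM2l// invr_ge0 ltW//.
rewrite /dir norm2Z ?invr_ge0 ?(ltW a0)// /norm2 w1 sqrtr1 mulr1 invrK scalerA divff ?scale1r//.
by rewrite gt_eqF.
Qed.
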